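(* Let $G$ be a graph. Then every connected induced subgraph of $G$ is dominated by an induced connected split graph (that is, for every connected induced subgraph $F$ of $G$ there is a dominating set $D$ of $F$ such that the induced subgraph $F[D]$ is a connected split graph) if and only if $G$ is $\mathcal{C}$-free, where $\mathcal{C}=\{P_7,C_7,Q_1,Q_2,Q_3,Q_4\}$.
   Context: All graphs are finite and simple. $P_\ell$ and $C_\ell$ denote the chordless path and the chordless cycle on $\ell$ vertices. For a set $\mathcal{L}$ of graphs, a graph is $\mathcal{L}$-free if it contains no induced subgraph isomorphic to a member of $\mathcal{L}$. A set $D\subseteq V(F)$ is a dominating set of a graph $F$ if every vertex of $V(F)\setminus D$ is adjacent to some vertex of $D$. A split graph is a graph whose vertex set can be partitioned into a stable set and a clique (either part may be empty). Attaching a leaf to a vertex $u$ of a graph means adding a new vertex $u'$ and the single edge $uu'$. The graphs $Q_1,\dots,Q_4$ are defined as follows. $Q_1$: the graph obtained from $C_5$ by attaching one leaf to each of its five vertices. $Q_2$: the graph obtained from $C_4$ by attaching one leaf to each of its four vertices. $H_1$: the graph with vertices $a,b,c,d,e$ and edges $ab,bc,ca,ad,de$. $Q_3$ is the graph obtained from $H_1$ by attaching one leaf to each of its non-cut vertices $b,c,e$. $H_2$: the graph with vertices $a,b,c,d,e$ and edges $ab,bc,ca,ad,de,ae$. $Q_4$ is the graph obtained from $H_2$ by attaching one leaf to each of its non-cut vertices $b,c,d,e$. *)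

(* Defs.v *)
From mathcomp Require Import all_boot.
Set Implicit Arguments.
Unset Strict Implicit.
Unset Printing Implicit Defensive.

Record sgraph := SGraph {
  vertex :> finType;
  edge : rel vertex;
  edge_sym : symmetric edge;
  edge_irrefl : irreflexive edge
}.
Arguments edge {s} _ _ : rename.

Section Induced.
Variables (G : sgraph) (A : {set G}).

Definition induced_edge : rel {x : G | x \in A} :=
  [rel x y | edge (val x) (val y)].

Lemma induced_edge_sym : symmetric induced_edge.
Proof. by move=> x y; apply: edge_sym. Qed.

Lemma induced_edge_irrefl : irreflexive induced_edge.
Proof. by move=> x; apply: edge_irrefl. Qed.

Definition induced : sgraph := SGraph induced_edge_sym induced_edge_irrefl.
End Induced.

Definition isomorphic (G H : sgraph) : Prop :=
  exists2 f : G -> H, bijective f & forall x y, edge (f x) (f y) = edge x y.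

Definition contains_induced (G H : sgraph) : Prop :=
  exists A : {set G}, isomorphic H (induced A).

Definition free (L : sgraph -> Prop) (G : sgraph) : Prop :=
  forall H, L H -> ~ contains_induced G H.

(* The graph without vertices is not connected. *)
Definition connected (G : sgraph) : Prop :=
  0 < #|G| /\ forall x y : G, connect edge x y.

Definition dominating (G : sgraph) (D : {set G}) : Prop :=
  forall x, x \notin D -> exists2 y, y \in D & edge x y.

Definition stable (G : sgraph) (S : {set G}) : Prop :=
  {in S &, forall x y, ~~ edge x y}.

Definition clique (G : sgraph) (K : {set G}) : Prop :=
  {in K &, forall x y, x != y -> edge x y}.

Definition split_graph (G : sgraph) : Prop :=
  exists S K : {set G},
    [/\ S :|: K = [set: G], [disjoint S & K], stable S & clique K].

(* Symmetric irreflexive closure of a relation, so that a concrete graph can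
   be given by listing each edge in one direction. *)
Section SymGraph.
Variables (T : finType) (r : rel T).

Definition sym_edge : rel T := [rel x y | (x != y) && (r x y || r y x)].

Lemma sym_edge_sym : symmetric sym_edge.
Proof. by move=> x y; rewrite /sym_edge /= eq_sym orbC. Qed.

Lemma sym_edge_irrefl : irreflexive sym_edge.
Proof. by move=> x; rewrite /sym_edge /= eqxx. Qed.

Definition sym_graph : sgraph := SGraph sym_edge_sym sym_edge_irrefl.
End SymGraph.

Definition path_graph (n : nat) : sgraph :=
  sym_graph [rel i j : 'I_n | i.+1 == j :> nat].

(* A cycle in the usual sense only for n >= 3. *)
Definition cycle_graph (n : nat) : sgraph :=
  sym_graph [rel i j : 'I_n | i.+1 %% n == j :> nat].

Definition graph_of_edges (n : nat) (s : seq (nat * nat)) : sgraph :=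
  sym_graph [rel i j : 'I_n | (nat_of_ord i, nat_of_ord j) \in s].

(* One leaf [inr u] is attached to each vertex [u] of [A]. *)
Definition attach_leaves (G : sgraph) (A : {set G}) : sgraph :=
  sym_graph (fun x y : G + {u : G | u \in A} =>
    match x, y with
    | inl u, inl v => edge u v
    | inl u, inr v => u == val v
    | inr _, _ => false
    end).

(* In H1 and H2 the vertices a, b, c, d, e are numbered 0, 1, 2, 3, 4. *)
Definition H1 : sgraph :=
  graph_of_edges 5 [:: (0, 1); (1, 2); (2, 0); (0, 3); (3, 4)].

Definition H2 : sgraph :=
  graph_of_edges 5 [:: (0, 1); (1, 2); (2, 0); (0, 3); (3, 4); (0, 4)].

Definition Q1 : sgraph := attach_leaves [set: cycle_graph 5].
Definition Q2 : sgraph := attach_leaves [set: cycle_graph 4].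
Definition Q3 : sgraph :=
  attach_leaves [set u : H1 | nat_of_ord u \in [:: 1; 2; 4]].
Definition Q4 : sgraph :=
  attach_leaves [set u : H2 | nat_of_ord u \in [:: 1; 2; 3; 4]].

Inductive forbidden : sgraph -> Prop :=
| forbidden_P7 : forbidden (path_graph 7)
| forbidden_C7 : forbidden (cycle_graph 7)
| forbidden_Q1 : forbidden Q1
| forbidden_Q2 : forbidden Q2
| forbidden_Q3 : forbidden Q3
| forbidden_Q4 : forbidden Q4.

(* Main.v *)
(** In a connected graph without forbidden subgraph, take a connected dominating
    set [D] for which 4 |E(D)| - 3 |D| is minimal; [D] induces a split graph.
    Otherwise [D] contains one of the minimal connected graphs that are not split,
    namely [P_5], [C_5], [C_4], [H_1] and [H_2]. Let [L] be this core. A vertex [y]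
    of [L] which is not a cut vertex of [L] has a leaf, i.e. a neighbour of [y]
    without any other neighbour in [L]: if [D - y] is connected, then by
    minimality it does not dominate, and [y] has a private neighbour outside [D];
    if not, any neighbour of [y] in another component of [D - y] will do.
    Moreover, if [D - y] is connected and [y] has degree at least 2 in [D],
    exchanging [y] for a few vertices that are successively pendant decreases
    4 |E(D)| - 3 |D|, so that some private neighbour of [y] is adjacent to none
    of these vertices. Starting from [L], these two rules produce more and more
    vertices whose adjacencies, however they are chosen, end up containing a
    forbidden subgraph. This case analysis is finite; it was found by a computer
    search and is recorded by certificates that a verified checker evaluates.
    Conversely, in each forbidden graph, the finitely many connected dominating sets
    are seen not to be split by enumeration. *)
Require Import Defs.
From mathcomp Require Import all_boot.
From mathcomp Require Import zify.
Set Implicit Arguments.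
Unset Strict Implicit.
Unset Printing Implicit Defensive.

(** * Connected sets and their weight *)

Section Connectivity.
Variable G : sgraph.
Implicit Types (B X : {set G}) (x y z : G).

(** Connectivity through cuts, stated for subsets of [G] so that vertices can be added and removed
    without changing the type. The empty set satisfies it. *)
Definition conn B : bool :=
  [forall X : {set G}, forall x in B :&: X, forall y in B :\: X,
     [exists u in B :&: X, [exists v in B :\: X, edge u v]]].

Lemma connP B :
  reflect (forall X x y, x \in B -> x \in X -> y \in B -> y \notin X ->
             exists u v, [/\ u \in B, u \in X, v \in B, v \notin X & edge u v])
          (conn B).
Proof.
apply: (iffP forallP) => [H X x y xB xX yB yX | H X].
  have /forall_inP /(_ x) := H X; rewrite inE xB xX => /(_ isT).
  move/forall_inP/(_ y); rewrite inE yX yB => /(_ isT).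
  case/exists_inP=> u /setIP[uB uX] /exists_inP[v /setDP[vB vX] uv].
  by exists u, v.
apply/forall_inP=> x /setIP[xB xX]; apply/forall_inP=> y /setDP[yB yX].
have [u [v [uB uX vB vX uv]]] := H X x y xB xX yB yX.
apply/exists_inP; exists u; first exact/setIP.
by apply/exists_inP; exists v => //; apply/setDP.
Qed.

Lemma connected_cut :
  connected G <-> 0 < #|G| /\
    forall X x y, x \in X -> y \notin X ->
      exists u v, [/\ u \in X, v \notin X & edge u v].
Proof.
split=> -[G0 H]; split=> //.
  move=> X x y xX yX.
  case: (boolP [exists u in X, [exists v in ~: X, edge u v]]).
    case/exists_inP=> u uX /exists_inP[v]; rewrite inE => vX uv.
    by exists u, v.
  move=> /exists_inP noX; case/negP: yX.
  have /connectP[p] := H x y; elim: p x xX => [|z p IH] x xX /=; first by move=> _ ->.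
  case/andP=> xz pz; apply: IH pz.
  case: (boolP (z \in X)) => // zX; case: noX; exists x => //.
  by apply/exists_inP; exists z => //; rewrite inE.
move=> x y; case: (boolP (connect edge x y)) => // nxy.
(* If [y] were not reachable, an edge would leave the set of vertices reachable from [x], which is
   closed under adjacency. *)
have [||u [v [uX vX uv]]] := H [set z | connect edge x z] x y.
- by rewrite inE connect0.
- by rewrite inE.
rewrite !inE in uX vX; case/negP: vX.
exact: connect_trans uX (connect1 uv).
Qed.

End Connectivity.

Lemma connected_induced (G : sgraph) (B : {set G}) :
  connected (induced B) <-> B != set0 /\ conn B.
Proof.
split=> [/connected_cut[B0 H]|[B0 /connP H]].
  split; first by move: B0; rewrite card_sig card_gt0; congr (_ != _); apply/setP=> x; rewrite !inE.
  apply/connP=> X x y xB xX yB yX.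
  have [||u [v [uX vX uv]]] := H [set z | val z \in X] (Sub x xB) (Sub y yB).
  - by rewrite inE.
  - by rewrite inE.
  rewrite !inE in uX vX.
  by exists (val u), (val v); rewrite uX vX; split=> //; apply: valP.
apply/connected_cut; split.
  by case/set0Pn: B0 => x xB; apply/card_gt0P; exists (Sub x xB).
move=> X x y xX yX.
have [||||u [v [uB uX vB vX uv]]] := H [set val z | z in X] (val x) (val y).
- exact: valP.
- exact: imset_f.
- exact: valP.
- by rewrite mem_imset //; apply: val_inj.
exists (Sub u uB), (Sub v vB); split=> //.
- by case/imsetP: uX => z zX uz; rewrite (_ : Sub u uB = z) //; apply: val_inj.
- apply: contra vX => vX; apply/imsetP; exists (Sub v vB) => //.
Qed.

Section Weight.
Variable G : sgraph.
Implicit Types (B X : {set G}) (x y z w : G).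

Lemma conn_add B w z : conn B -> z \in B -> edge w z -> conn (w |: B).
Proof.
move=> /connP cB zB wz; apply/connP=> X x y xB xX yB yX.
have zw : edge z w by rewrite edge_sym.
have wwB : w \in w |: B by rewrite setU11.
have sB u : u \in B -> u \in w |: B by move=> uB; rewrite inE uB orbT.
have cross a b : a \in B -> a \in X -> b \in B -> b \notin X ->
    exists u v, [/\ u \in w |: B, u \in X, v \in w |: B, v \notin X & edge u v].
  move=> aB aX bB bX; have [u [v [uB uX vB vX uv]]] := cB X a b aB aX bB bX.
  by exists u, v; split; rewrite ?sB.
case: (boolP (z \in X)) => zX; case: (boolP (w \in X)) => wX.
- case/setU1P: yB => [yw|yB]; first by rewrite -yw (negbTE yX) in wX.
  exact: cross zB zX yB yX.
- by exists z, w; split=> //; apply: sB.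
- by exists w, z; split=> //; apply: sB.
case/setU1P: xB => [xw|xB]; first by rewrite -xw xX in wX.
exact: cross xB xX zB zX.
Qed.

Definition deg B w := #|[set z in B | edge w z]|.

(* 4 |E(B)| - 3 |B|, shifted by 3 |V(G)| so as to stay in [nat]. *)
Definition weight B := 2 * (\sum_(u in B) deg B u) + 3 * #|~: B|.

Lemma deg_gt0 B w z : z \in B -> edge w z -> 0 < deg B w.
Proof. by move=> zB wz; apply/card_gt0P; exists z; rewrite inE zB. Qed.

(** Each of the [deg B w] new edges enters the degree sum twice, hence the weight four times, while
    the complement loses one vertex. The 3 stands on the left to avoid truncated subtraction. *)
Lemma weight_add B w : w \notin B -> weight (w |: B) + 3 = weight B + 4 * deg B w.
Proof.
move=> wB; rewrite /weight big_setU1 //=.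
have -> : deg (w |: B) w = deg B w.
  apply: eq_card => z; rewrite !inE.
  by case: (z =P w) => [->|] //=; rewrite edge_irrefl andbF.
have dE u : u \in B -> deg (w |: B) u = deg B u + edge u w.
  move=> uB; rewrite /deg.
  rewrite (_ : [set z in w |: B | edge u z] =
    (if edge u w then [set w] else set0) :|: [set z in B | edge u z]); last first.
    apply/setP=> z; case uw: (edge u w); rewrite !inE.
      by case: (z =P w) => [->|] //=; rewrite uw.
    by case: (z =P w) => [->|] //=; rewrite uw andbF.
  case: ifP => uw; last by rewrite set0U addn0.
  by rewrite cardsU1 inE (negbTE wB) addnC.
rewrite (eq_bigr _ dE) big_split /=.
have -> : \sum_(u in B) edge u w = deg B w.
  rewrite /deg -sum1dep_card big_mkcondr /=.
  by apply: eq_bigr => u _; rewrite edge_sym; case: edge.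
rewrite setCU setIC -setDE; have := cardsD1 w (~: B); rewrite inE wB; lia.
Qed.

Lemma weight_del B w : w \in B -> weight B + 3 = weight (B :\ w) + 4 * deg (B :\ w) w.
Proof. by move=> wB; rewrite -[B in LHS](setD1K wB) weight_add // setD11. Qed.

End Weight.

(** * Dominating sets of minimal weight *)

Section Optimal.
Variable G : sgraph.
Implicit Types (B D : {set G}).

Definition dominates D : bool := [forall x, (x \in D) || [exists y in D, edge x y]].

Definition optimal D :=
  [/\ conn D, dominates D &
      forall B, B != set0 -> conn B -> dominates B -> weight D <= weight B].

Lemma optimal_exists : connected G -> exists2 D, D != set0 & optimal D.
Proof.
case/connected_cut=> G0 cutG.
pose good B := [&& B != set0, conn B & dominates B].
have goodT : good setT.
  apply/and3P; split.
  - by have /card_gt0P[x _] := G0; apply/set0Pn; exists x.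
  - apply/connP=> X x y _ xX _ yX; have [u [v [uX vX uv]]] := cutG X x y xX yX.
    by exists u, v.
  - by apply/forallP=> x; rewrite inE.
have [D /and3P[D0 cD dD] minD] := arg_minnP (@weight G) goodT.
by exists D => //; split=> // B B0 cB dB; apply: minD; apply/and3P.
Qed.

Lemma not_dominates B :
  ~~ dominates B -> exists2 r, r \notin B & {in B, forall z, ~~ edge r z}.
Proof.
case/forallPn=> r; rewrite negb_or => /andP[rB /exists_inPn H].
by exists r.
Qed.

Lemma dominatesP D r : dominates D -> r \notin D -> exists2 z, z \in D & edge r z.
Proof. by move=> /forallP/(_ r)/orP[->//|/exists_inP[z zD rz] _]; exists z. Qed.

Variables (D : {set G}) (k : nat) (x : nat -> G).
Hypothesis optD : optimal D.
Hypothesis xD : forall i, i < k -> x i \in D.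
Hypothesis x_inj : forall i j, i < k -> j < k -> x i = x j -> i = j.

(* In the second case [Y] is a union of components of [D :\ x j]. *)
Definition is_leaf j p : Prop :=
  if conn (D :\ x j) then p \notin D /\ {in D, forall z, edge p z = (z == x j)}
  else exists Y : {set G},
    [/\ p \in Y, edge p (x j), Y \subset D :\ x j, forall i, i < k -> x i \notin Y &
        forall u v, u \in Y -> v \in D :\ x j -> edge u v -> v \in Y].

Lemma xE i j : i < k -> j < k -> (x i == x j) = (i == j).
Proof. by move=> ik jk; apply/eqP/eqP=> [/x_inj->|->]. Qed.

(** If [D :\ x j] is disconnected, an adjacency to another core vertex would pull that vertex into
    [Y], which avoids the core. *)
Lemma leaf_adj j p i : j < k -> i < k -> is_leaf j p -> edge p (x i) = (i == j).
Proof.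
move=> jk ik; rewrite /is_leaf; case: ifP => _ [].
  by move=> _ H; rewrite H ?xD ?xE.
move=> Y [pY px _ xY cY]; case: eqP => [->//|/eqP ij].
apply/negP=> pxi; case/negP: (xY _ ik); apply: cY pxi => //.
by rewrite !inE xE // ij xD.
Qed.

(** Suppose that [D :\ x j] is disconnected, so that [p] lies in [D]. Then [q] does too, since
    otherwise its only neighbour in [D] is [x l], which is not in [Y]. Hence [q], and then its
    neighbour [x l], fall into [Y], which avoids the core. *)
Lemma leaf_conn j l p q : j < k -> l < k -> j != l -> is_leaf j p -> is_leaf l q ->
  edge p q -> conn (D :\ x j).
Proof.
move=> jk lk jl; rewrite {1}/is_leaf; case: ifP => // _ [Y [pY px YD xY cY]] lq pq.
have pD : p \in D by have := subsetP YD p pY; rewrite !inE => /andP[].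
have qDj : q \in D :\ x j /\ edge q (x l).
  split; last by rewrite (leaf_adj lk lk lq) eqxx.
  move: lq; rewrite /is_leaf; case: ifP => _ [].
    move=> qD H; move: (H p pD); rewrite edge_sym pq => /esym/eqP pE.
    by move: (xY l lk); rewrite -pE pY.
  move=> Z [qZ _ ZD xZ _]; rewrite !inE.
  have := subsetP ZD q qZ; rewrite !inE => /andP[_ ->]; rewrite andbT.
  by apply: contraNneq (xZ j jk) => <-.
have qY := cY _ _ pY qDj.1 pq.
case/negP: (xY l lk); apply: cY qY _ qDj.2.
by rewrite !inE xE // eq_sym jl xD.
Qed.

Lemma leaf_exists j i : j < k -> i < k -> edge (x j) (x i) ->
  conn [set x l | l : 'I_k & val l != j] -> exists p, is_leaf j p.
Proof.
case: optD => cD dD minD jk ik ji core.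
have ij : i != j by apply: contraTneq ji => ->; rewrite edge_irrefl.
have iDj : x i \in D :\ x j by rewrite !inE xE // ij xD.
case cDj: (conn (D :\ x j)).
  (* The neighbour [x i] gives [x j] degree at least 1 in [D], so deleting [x j] lowers the weight
     by at least 4 - 3. *)
  have ndom : ~~ dominates (D :\ x j).
    apply/negP=> dom; have Dj0 : D :\ x j != set0 by apply/set0Pn; exists (x i).
    have := minD _ Dj0 cDj dom; rewrite leqNgt => /negP; apply.
    by have := weight_del (xD jk); have := deg_gt0 iDj ji; lia.
  have [r rDj rH] := not_dominates ndom.
  have rx : r != x j by apply: contraNneq (rH _ iDj) => ->.
  have rD : r \notin D by move: rDj; rewrite !inE rx.
  have [z zD rz] := dominatesP dD rD.
  have zx : z = x j.
    by apply/eqP; apply: contraTT rz => zx; apply: rH; rewrite !inE zx.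
  exists r; rewrite /is_leaf cDj; split=> // u uD.
  apply/idP/eqP=> [ru|->]; last by rewrite -zx.
  by apply/eqP; apply: contraTT ru => ux; apply: rH; rewrite !inE ux.
have [X [u [v [uD uX vD vX noX]]]] : exists (X : {set G}) (u v : G),
    [/\ u \in D :\ x j, u \in X, v \in D :\ x j, v \notin X &
      {in D :\ x j &, forall a b, a \in X -> b \notin X -> ~~ edge a b}].
  move: cDj => /negbT/forallPn[X]; rewrite negb_forall_in => /exists_inP[u /setIP[uD uX]].
  rewrite negb_forall_in => /exists_inP[v /setDP[vD vX]] H.
  exists X, u, v; split=> // a b aD bD aX bX; apply: contra H => ab.
  apply/exists_inP; exists a; first exact/setIP.
  by apply/exists_inP; exists b => //; apply/setDP.
(* The rest of the core is connected, hence on one side of the separation; [Z] is the other side. *)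
have [Z [z [zD zZ coreZ closedZ]]] : exists (Z : {set G}) (z : G), [/\ z \in D :\ x j, z \in Z,
     forall l, l < k -> l != j -> x l \notin Z &
     forall a b, a \in Z -> a \in D :\ x j -> b \in D :\ x j -> edge a b -> b \in Z].
  have mono l l' : l < k -> l != j -> l' < k -> l' != j -> x l \in X -> x l' \in X.
    move=> lk lj l'k l'j lX; case: (boolP (x l' \in X)) => // l'X.
    have im m : m < k -> m != j -> x m \in [set x l | l : 'I_k & val l != j].
      by move=> mk mj; apply/imsetP; exists (Ordinal mk); rewrite ?inE.
    have [a [b [/imsetP[a' a'j ->] aX /imsetP[b' b'j ->] bX ab]]] :=
      connP _ core X _ _ (im _ lk lj) lX (im _ l'k l'j) l'X.
    have xDj m : m < k -> m != j -> x m \in D :\ x j.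
      by move=> mk mj; rewrite !inE xE // mj xD.
    rewrite !inE in a'j b'j.
    by rewrite (negbTE (noX _ _ (xDj _ (ltn_ord a') a'j) (xDj _ (ltn_ord b') b'j) aX bX)) in ab.
  case: (boolP (x i \in X)) => iX.
    exists (~: X), v; split=> // [|l lk lj|a b].
    - by rewrite in_setC.
    - by rewrite in_setC negbK (mono i).
    - rewrite !in_setC => aX aD bD ab; apply/negP=> bX.
      by move: ab; rewrite edge_sym (negbTE (noX b a bD aD bX aX)).
  exists X, u; split=> // [l lk lj|a b aX aD bD ab].
    by apply: contra iX; apply: mono.
  by apply: contraTT ab => bX; apply: noX.
pose Y := Z :&: (D :\ x j).
have zY : z \in Y by rewrite !inE in zD *; rewrite zZ.
have xjY : x j \notin Y by rewrite !inE eqxx andbF.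
have zD' : z \in D by rewrite !inE in zD; case/andP: zD.
(* An edge of [D] leaving [Y] can only end in [x j], because [Y] is closed in [D :\ x j]; its other
   end is the leaf. *)
have [a [b [aD aY bD bY ab]]] := connP _ cD Y _ _ zD' zY (xD jk) xjY.
have /setIP[aZ aDj] := aY.
have bx : b = x j.
  apply/eqP; apply: contraNT bY => bx.
  have bDj : b \in D :\ x j by rewrite in_setD1 bx bD.
  by apply/setIP; split=> //; apply: closedZ ab.
exists a; rewrite /is_leaf cDj; exists Y; split=> //.
- by rewrite -bx.
- exact: subsetIr.
- move=> l lk; case: (l =P j) => [->//|/eqP lj].
  by rewrite in_setI (negbTE (coreZ l lk lj)).
by move=> s t /setIP[sZ sD] tD st; apply/setIP; split=> //; apply: closedZ st.
Qed.

(* [W] is glued, from its last vertex to its first one, as a sequence of pendant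
   vertices: this keeps the connectivity and increases the weight by 1 per vertex,
   whereas the deletion of a vertex of degree at least 2 gains at least 5. *)
Fixpoint pendant_seq (B : {set G}) (W : seq G) : Prop :=
  if W is w :: W' then
    pendant_seq B W' /\ deg (B :|: [set:: W']) w = 1
  else True.

Lemma pendant_weight B W : conn B -> pendant_seq B W ->
  conn (B :|: [set:: W]) /\ weight (B :|: [set:: W]) <= weight B + size W.
Proof.
move=> cB; elim: W => [_|w W IH] /=.
  by rewrite (_ : _ :|: _ = B) ?addn0 //; apply/setP=> z; rewrite !inE orbF.
case=> /IH[cW wW] dw.
have -> : B :|: [set:: w :: W] = w |: (B :|: [set:: W]).
  by apply/setP=> z; rewrite !inE orbCA.
(* A vertex that is already present changes nothing; a new one adds 4 - 3 to the weight. *)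
case: (boolP (w \in B :|: [set:: W])) => win.
  by rewrite (setUidPr _) ?sub1set //; split=> //; lia.
have := weight_add win; rewrite dw; split; last lia.
have /card_gt0P[z] : 0 < deg (B :|: [set:: W]) w by rewrite dw.
by rewrite inE => /andP[zB wz]; apply: conn_add zB wz.
Qed.

Lemma leaf_swap j W : j < k -> conn (D :\ x j) -> 1 < deg D (x j) ->
  pendant_seq (D :\ x j) W -> size W <= 4 ->
  exists2 r, is_leaf j r & {in W, forall w, ~~ edge r w}.
Proof.
case: optD => cD dD minD jk cDj dj pW sW.
have [cB wB] := pendant_weight cDj pW; set B := _ :|: _ in cB wB.
have degE : deg (D :\ x j) (x j) = deg D (x j).
  apply: eq_card => z; rewrite !inE.
  by case: (z =P x j) => [->|] //=; rewrite edge_irrefl andbF.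
have wD := weight_del (xD jk); rewrite degE in wD.
have /card_gt0P[y] : 0 < deg (D :\ x j) (x j) by rewrite degE; lia.
rewrite inE => /andP[yD xy].
(* Deleting [x j] saves at least 8 - 3 = 5 and [W] costs at most 4, so a dominating [B] would
   contradict the minimality of [D]. *)
have ndom : ~~ dominates B.
  apply/negP=> dom; have B0 : B != set0 by apply/set0Pn; exists y; rewrite inE yD.
  by have := minD B B0 cB dom; lia.
have [r rB rH] := not_dominates ndom.
have rx : r != x j.
  by apply: contraNneq (rH y _) => [->//|]; rewrite inE yD.
have rD : r \notin D by move: rB; rewrite !inE rx; case: (r \in D).
have rN z : z \in D -> z != x j -> ~~ edge r z.
  by move=> zD zx; apply: rH; rewrite !inE zD zx.
exists r; last by move=> w wW; apply: rH; rewrite !inE wW orbT.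
have [z zD rz] := dominatesP dD rD.
have zx : z = x j by apply/eqP; apply: contraTT rz; apply: rN.
rewrite /is_leaf cDj; split=> // u uD; apply/idP/eqP=> [ru|->]; last by rewrite -zx.
by apply/eqP; apply: contraTT ru; apply: rN.
Qed.

End Optimal.

(** * Certificates *)

Definition adj (es : seq (nat * nat)) (i j : nat) : bool :=
  (i != j) && (((i, j) \in es) || ((j, i) \in es)).

Lemma adj_sym es i j : adj es i j = adj es j i.
Proof. by rewrite /adj eq_sym orbC. Qed.

(* The leaf attached to the vertex [u] is [n + u], so that [A <> iota 0 n] leaves gaps. *)
Definition leafy (n : nat) (es : seq (nat * nat)) (A : seq nat) :=
  (iota 0 n ++ [seq n + u | u <- A], es ++ [seq (u, n + u) | u <- A]).

Definition path_edges n := [seq (i, i.+1) | i <- iota 0 n.-1].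
Definition cycle_edges n := (n.-1, 0) :: path_edges n.
Definition H1_edges := [:: (0, 1); (1, 2); (2, 0); (0, 3); (3, 4)].
Definition H2_edges := rcons H1_edges (0, 4).

(** The order is that of [pattern_graph]. [P_7] and [C_7] come first because [PathOrCycle] turns the
    adjacency of the two ends into the index 0 or 1. *)
Definition patterns : seq (seq nat * seq (nat * nat)) :=
  [:: leafy 7 (path_edges 7) [::]; leafy 7 (cycle_edges 7) [::];
      leafy 5 (cycle_edges 5) (iota 0 5); leafy 4 (cycle_edges 4) (iota 0 4);
      leafy 5 H1_edges [:: 1; 2; 4]; leafy 5 H2_edges [:: 1; 2; 3; 4]].

Definition pattern f := nth ([::], [::]) patterns f.

(** Only adjacencies are recorded; [realizes_inj] recovers injectivity from them. *)
Definition realizes (G : sgraph) (P : seq nat * seq (nat * nat)) (e : nat -> G) :=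
  {in P.1 &, forall i j, edge (e i) (e j) = adj P.2 i j}.

Fixpoint buildable es (o : seq nat) :=
  if o is i :: o' then nilp o' || has (adj es i) o' && buildable es o' else true.

(** Read backwards, the list attaches each vertex to one placed before it. *)
Lemma conn_buildable (G : sgraph) es s (e : nat -> G) :
  realizes (s, es) e -> buildable es s -> conn [set:: map e s].
Proof.
elim: s => [_ _|a o IH re /= bo].
  by apply/connP=> X u v; rewrite !inE.
have aS : [set:: e a :: map e o] = e a |: [set:: map e o].
  by apply/setP=> z; rewrite !inE.
rewrite aS; case/orP: bo => [/nilP->|/andP[/hasP[b bo ab] bo']].
  apply/connP=> X u v; rewrite !inE !orbF => /eqP-> uX /eqP->.
  by rewrite uX.
have sub : {subset o <= a :: o} by move=> c co; rewrite inE co orbT.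
apply: (@conn_add _ _ _ (e b)).
- by apply: IH => // i j io jo; apply: re; apply: sub.
- by rewrite inE; apply: map_f.
- by rewrite re ?mem_head ?sub.
Qed.

(* The vertices of the core are numbered from 0 to [k - 1], and the leaves from [k]
   on, in the order of their introduction.
   - [Copy f e]: the known adjacencies make [e] a copy of the pattern [f].
   - [PathOrCycle e]: [e] is a copy of [P_7] or [C_7], according to whether its two
     ends are adjacent.
   - [Leaf i c]: introduce a leaf of the vertex [i] of the core.
   - [Swap i W c]: introduce a leaf of [i] adjacent to no vertex of [W].
   - [Branch v c0 c1]: the newest vertex is not adjacent to [v] in [c0], and is in
     [c1]. *)
Inductive cert :=
  | Copy of nat & seq nat
  | PathOrCycle of seq nat
  | Leaf of nat & cert
  | Swap of nat & seq nat & cert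
  | Branch of nat & cert & cert.

(** * The certificate checker *)

Section Checker.
Variables (k : nat) (es : seq (nat * nat)) (ends : seq (nat * seq nat)).

(* [ends] lists the non-cut vertices of the core, with an enumeration of the other
   ones in which each vertex but the last one has a neighbour further on.
   In a state, leaf number [k + m] is attached to [nth 0 tags m], the pairs in [E]
   are adjacent and the pairs in [F] are not. *)
Section State.
Variables (tags : seq nat) (E F : seq (nat * nat)).

Let N := k + size tags.

Definition tag u := nth 0 tags (u - k).

(** [None] means that the adjacency of two leaves has not been decided so far. *)
Definition status u v : option bool :=
  if u < k then Some (if v < k then adj es u v else tag v == u)
  else if v < k then Some (tag u == v)
  else if ((u, v) \in E) || ((v, u) \in E) then Some true
  else if (u == v) || ((u, v) \in F) || ((v, u) \in F) then Some false
  else None.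

(* The leaves of two distinct core vertices can only be adjacent when they are
   private neighbours outside [D]. *)
Definition active j :=
  has (fun p => (tag p.1 != tag p.2) && ((tag p.1 == j) || (tag p.2 == j))) E.

(** The numbers of all leaves introduced so far, whether these lie inside or outside [D]. *)
Definition private u := k <= u < N.

(** When [tag w] is active, [w] lies outside [D] and sees only [x (tag w)] there. If [tag w] is [i],
    this neighbour has been deleted and [w] must see exactly one vertex of [W']; otherwise it
    remains and [w] must see none of [W']. *)
Fixpoint pendants i W :=
  if W is w :: W' then
    [&& pendants i W', private w, active (tag w) &
        if tag w == i then
          (size [seq u <- W' | status w u == Some true] == 1) &&
          all (fun u => status w u != None) W'
        else all (fun u => status w u == Some false) W']
  else true.

(** [e] follows the order of [P.1], whose numbers may have gaps; hence the use of [index]. *)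
Definition copy_ok f e :=
  let P := pattern f in let at_ i := nth 0 e (index i P.1) in
  [&& f < size patterns, all (fun i => at_ i < N) P.1 &
      all (fun i => all (fun j => status (at_ i) (at_ j) == Some (adj P.2 i j)) P.1) P.1].

(** The exempted pair, with sum 6 and product 0, consists of the ends 0 and 6. *)
Definition path_or_cycle_ok e :=
  all (fun i => nth 0 e i < N) (iota 0 7) &&
  all (fun i => all (fun j => (i + j == 6) && (i * j == 0) ||
    (status (nth 0 e i) (nth 0 e j) == Some (adj (path_edges 7) i j)))
    (iota 0 7)) (iota 0 7).

End State.

(** [N] is the number of the next leaf, so [Swap] can record its non-adjacencies at once. The degree
    counted within the core is a lower bound for the degree in [D]. *)
Fixpoint check c tags E F :=
  let N := k + size tags in
  match c with
  | Copy f e => copy_ok tags E F f e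
  | PathOrCycle e => path_or_cycle_ok tags E F e
  | Leaf i c => (i \in unzip1 ends) && check c (rcons tags i) E F
  | Swap i W c =>
      [&& i \in unzip1 ends, active tags E i, 1 < count (adj es i) (iota 0 k),
          pendants tags E F i W, size W <= 4 &
          check c (rcons tags i) E ([seq (N, w) | w <- W] ++ F)]
  | Branch v c0 c1 =>
      let u := N.-1 in
      [&& private tags u, private tags v,
          check c0 tags E ((u, v) :: F) & check c1 tags ((u, v) :: E) F]
  end.

Definition end_ok (p : nat * seq nat) :=
  [&& p.1 < k, has (adj es p.1) p.2, buildable es p.2,
      all (fun i => (i < k) && (i != p.1)) p.2 &
      all (fun i => (i == p.1) || (i \in p.2)) (iota 0 k)].

(** * Soundness of the checker *)

Variables (G : sgraph) (D : {set G}) (x : nat -> G).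
Hypothesis no_pattern :
  forall f (e : nat -> G), f < size patterns -> ~ realizes (pattern f) e.
Hypothesis optD : optimal D.
Hypothesis xD : forall i, i < k -> x i \in D.
Hypothesis x_inj : forall i j, i < k -> j < k -> x i = x j -> i = j.
Hypothesis x_adj : forall i j, i < k -> j < k -> edge (x i) (x j) = adj es i j.
Hypothesis endsP : all end_ok ends.

Notation leaf := (is_leaf D k x).

Lemma ends_lt j : j \in unzip1 ends -> j < k.
Proof. by case/mapP=> p /(allP endsP)/and5P[pk _ _ _ _] ->. Qed.

Lemma ends_leaf j : j \in unzip1 ends -> exists p, leaf j p.
Proof.
case/mapP=> -[j' o] jo /= -> {j}; have := allP endsP _ jo.
case/and5P=> /= jk /hasP[i io ji] bo /allP ok /allP oall.
have /andP[ik ij] := ok i io.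
apply: (leaf_exists optD xD x_inj jk ik); first by rewrite x_adj.
have -> : [set x (val l) | l : 'I_k & val l != j'] = [set:: map x o].
  apply/setP=> z; rewrite inE; apply/imsetP/mapP=> [[l]|[l lo ->]].
    rewrite inE => lj ->; exists (val l) => //.
    by have := oall (val l); rewrite mem_iota /= ltn_ord (negbTE lj); apply.
  by have /andP[lk lj] := ok l lo; exists (Ordinal lk); rewrite ?inE.
apply: conn_buildable bo => a b ao bo'.
by have /andP[ak _] := ok a ao; have /andP[bk _] := ok b bo'; apply: x_adj.
Qed.

(** The invariant of the checker: [nu] interprets the numbers of a state as vertices of [G] for
    which all recorded facts hold. *)
Record fits (tags : seq nat) (E F : seq (nat * nat)) (nu : nat -> G) : Prop := Fits {
  fits_core : forall i, i < k -> nu i = x i;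
  fits_tag : forall u, private tags u -> tag tags u \in unzip1 ends;
  fits_leaf : forall u, private tags u -> leaf (tag tags u) (nu u);
  fits_E : forall u v, (u, v) \in E -> [/\ private tags u, private tags v & edge (nu u) (nu v)];
  fits_F : forall u v, (u, v) \in F -> [/\ private tags u, private tags v & ~~ edge (nu u) (nu v)] }.

Section Fits.
Variables (tags : seq nat) (E F : seq (nat * nat)) (nu : nat -> G).
Hypothesis fit : fits tags E F nu.

Lemma fits_adj u i : private tags u -> i < k -> edge (nu u) (x i) = (tag tags u == i).
Proof.
move=> pu ik; rewrite eq_sym; apply: (leaf_adj xD x_inj) ik (fits_leaf fit pu).
exact: ends_lt (fits_tag fit pu).
Qed.

Lemma statusP u v b : u < k + size tags -> v < k + size tags ->
  status tags E F u v = Some b -> edge (nu u) (nu v) = b.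
Proof.
move=> uN vN; rewrite /status.
case: (ltnP u k) => uk; case: (ltnP v k) => vk.
- by case=> <-; rewrite !(fits_core fit) // x_adj.
- by case=> <-; rewrite edge_sym [nu u](fits_core fit) // fits_adj // /private vk.
- by case=> <-; rewrite [nu v](fits_core fit) // fits_adj // /private uk.
case: ifP => [/orP[]/(fits_E fit)[_ _]|_]; first by move=> ? [<-].
  by rewrite edge_sym => ? [<-].
case: ifP => // /orP[/orP[/eqP->|]|] => [[<-]|/(fits_F fit)[_ _]|/(fits_F fit)[_ _]].
- by rewrite edge_irrefl.
- by move=> /negbTE ? [<-].
- by rewrite edge_sym => /negbTE ? [<-].
Qed.

Lemma activeP j : active tags E j -> j < k /\ conn (D :\ x j).
Proof.
case/hasP=> -[u v] /(fits_E fit)[pu pv uv] /= /andP[tuv].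
have tu := ends_lt (fits_tag fit pu); have tv := ends_lt (fits_tag fit pv).
have lu := fits_leaf fit pu; have lv := fits_leaf fit pv.
case/orP=> /eqP<-; split=> //; first exact: (leaf_conn xD x_inj) lu lv uv.
by rewrite edge_sym in uv; rewrite eq_sym in tuv; apply: (leaf_conn xD x_inj) lv lu uv.
Qed.

Lemma pendantsP i W : i < k -> pendants tags E F i W ->
  {subset W <= private tags} /\ pendant_seq (D :\ x i) (map nu W).
Proof.
move=> ik; elim: W => //= w W IH /and4P[/IH[pW pnd] pw actw okw].
split; first by move=> z; rewrite inE => /predU1P[->|/pW].
split=> //.
have [tk ctw] := activeP actw.
(* Since [D :\ x (tag tags w)] is connected, the first case of [is_leaf] determines all neighbours
   of [w] in [D]. *)
have Dw z : z \in D -> edge (nu w) z = (z == x (tag tags w)).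
  by have := fits_leaf fit pw; rewrite /is_leaf ctw => -[_]; apply.
have ltN u : private tags u -> u < k + size tags by case/andP.
have stW u b : u \in W -> status tags E F w u = Some b -> edge (nu w) (nu u) = b.
  by move=> uW; apply: statusP; apply: ltN => //; apply: pW.
move: okw; case: (tag tags w =P i) => [ti|/eqP ti].
  case/andP=> szW /allP known.
  have [u fE] : exists u, [seq u <- W | status tags E F w u == Some true] = [:: u].
    by move: szW; case: filter => [|u []] // _; exists u.
  have fP v : v \in W -> (status tags E F w v == Some true) = (v == u).
    by move=> vW; have := mem_filter (fun v => status tags E F w v == Some true) v W;
       rewrite fE inE vW andbT => ->.
  have uW : u \in W by have := mem_head u [::]; rewrite -fE mem_filter => /andP[].
  rewrite /deg (_ : [set z in _ | _] = [set nu u]) ?cards1 //.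
  apply/setP=> z; rewrite !inE; apply/andP/eqP=> [[zB wz]|->]; last first.
    by rewrite map_f ?orbT //; split=> //; apply: stW => //; apply/eqP; rewrite fP.
  case/orP: zB => [/andP[zi zD]|/mapP[v vW zv]].
    by move: wz; rewrite Dw // ti (negbTE zi).
  rewrite zv; congr nu; apply/eqP; rewrite -fP //.
  have := known v vW; case st: status => [[]|] // _.
  by move: wz; rewrite zv (stW v false).
move/allP=> non.
rewrite /deg (_ : [set z in _ | _] = [set x (tag tags w)]) ?cards1 //.
apply/setP=> z; rewrite !inE; apply/andP/eqP=> [[zB wz]|->].
  case/orP: zB => [/andP[zi zD]|/mapP[v vW zv]]; first by apply/eqP; rewrite -Dw.
  by move: wz; rewrite zv (stW v false) //; apply/eqP/non.
have xtD := xD tk.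
by rewrite Dw // eqxx xtD (xE x_inj tk ik) ti.
Qed.

(** Serves both [Leaf] and [Swap]: the new leaf gets the number [k + size tags], and every new entry
    of [F'] starts with it. *)
Lemma fits_rcons i p E' F' : i \in unzip1 ends -> leaf i p ->
  {subset E' <= E} ->
  (forall u v, (u, v) \in F' -> (u, v) \in F \/
     [/\ u = k + size tags, private tags v & ~~ edge p (nu v)]) ->
  fits (rcons tags i) E' F' (fun u => if u == k + size tags then p else nu u).
Proof.
move=> iends lp sE sF; set N := k + size tags.
have prN u : private (rcons tags i) u -> u = N \/ private tags u.
  by rewrite /private size_rcons addnS -/N; case: (u =P N); [left | right; lia].
have prS u : private tags u -> private (rcons tags i) u.
  by rewrite /private size_rcons addnS -/N; lia.
have NN : private (rcons tags i) N by rewrite /private size_rcons /N; lia.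
have neN u : private tags u -> (u == N) = false by rewrite /private -/N; lia.
have tagN : tag (rcons tags i) N = i by rewrite /tag nth_rcons /N addKn ltnn eqxx.
have tagS u : private tags u -> tag (rcons tags i) u = tag tags u.
  by rewrite /tag nth_rcons /private => /andP[ku uN]; rewrite (_ : u - k < _) //; lia.
split.
- move=> j jk; rewrite (_ : (j == N) = false) ?(fits_core fit) //.
  by rewrite /N; lia.
- by move=> u /prN[->|pu]; rewrite ?tagN // tagS // (fits_tag fit).
- by move=> u /prN[->|pu]; rewrite ?eqxx ?tagN // neN // tagS // ; apply: (fits_leaf fit).
- move=> u v /sE/(fits_E fit)[pu pv uv]; rewrite !neN //.
  by split=> //; apply: prS.
- move=> u v /sF[/(fits_F fit)[pu pv uv]|[-> pv pN]].
    by rewrite !neN //; split=> //; apply: prS.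
  by rewrite eqxx neN //; split=> //; apply: prS.
Qed.

End Fits.

Lemma deg_count j : j < k -> count (adj es j) (iota 0 k) <= deg D (x j).
Proof.
move=> jk; rewrite -size_filter.
set s := filter _ _.
have sk i : i \in s -> i < k by rewrite mem_filter mem_iota => /andP[].
have us : uniq (map x s).
  rewrite map_inj_in_uniq ?filter_uniq ?iota_uniq // => a b /sk ak /sk bk.
  exact: x_inj.
rewrite -(size_map x) -(card_uniqP us) /deg; apply: subset_leq_card.
apply/subsetP=> z /mapP[i is_ ->]; rewrite inE xD ?x_adj //; last exact: sk.
  by move: is_; rewrite mem_filter => /andP[].
exact: sk.
Qed.

(** Each rule that branches or introduces a leaf passes the realisation on to one of its subtrees,
    and a terminal rule would exhibit a pattern. *)
Lemma check_sound c tags E F nu : fits tags E F nu -> ~~ check c tags E F.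
Proof.
elim: c tags E F nu => [f e|e|i c IH|i W c IH|v c0 IH0 c1 IH1] tags E F nu fit /=.
- apply/negP=> /and3P[fP /allP lt_at /allP ok].
  apply: (no_pattern (e := fun i => nu (nth 0 e (index i (pattern f).1))) fP).
  move=> i j iP jP; apply: (statusP fit); try exact: lt_at.
  by apply/eqP; move/allP: (ok i iP); apply.
- apply/negP=> /andP[/allP lt_e /allP ok].
  have st i j : i < 7 -> j < 7 -> ~~ ((i + j == 6) && (i * j == 0)) ->
      edge (nu (nth 0 e i)) (nu (nth 0 e j)) = adj (path_edges 7) i j.
    move=> i7 j7 /negbTE ij; have i7' : i \in iota 0 7 by rewrite mem_iota.
    have j7' : j \in iota 0 7 by rewrite mem_iota.
    apply: (statusP fit); try exact: lt_e.
    by apply/eqP; move/allP: (ok i i7') => /(_ j j7'); rewrite ij.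
  pose f := edge (nu (nth 0 e 0)) (nu (nth 0 e 6)) : nat.
  have f2 : f < size patterns by rewrite /f; case: edge.
  apply: (no_pattern (e := fun i => nu (nth 0 e i)) f2) => i j.
  have -> : (pattern f).1 = iota 0 7 by rewrite /f; case: edge.
  rewrite !mem_iota /= => i7 j7; case: (boolP ((i + j == 6) && (i * j == 0))) => ij.
    have [[-> ->]|[-> ->]] : i = 0 /\ j = 6 \/ i = 6 /\ j = 0 by nia.
      by rewrite /f; case: edge.
    by rewrite edge_sym /f; case: edge.
  rewrite st // /f; case: edge => //.
  (* Apart from the pair of ends, the path and the cycle have the same adjacencies. *)
  have agree : all (fun i => all (fun j => (i + j == 6) && (i * j == 0) ||
      (adj (path_edges 7) i j == adj (cycle_edges 7) i j)) (iota 0 7)) (iota 0 7) by [].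
  move/allP: agree => /(_ i); rewrite mem_iota => /(_ i7)/allP/(_ j).
  by rewrite mem_iota (negbTE ij) => /(_ j7)/eqP.
- apply/negP=> /andP[iends]; have [p lp] := ends_leaf iends.
  apply/negP; apply: IH (fits_rcons fit iends lp _ _) => //.
  by move=> u v ->; left.
- apply/negP=> /and5P[iends acti cnt pnd /andP[szW]].
  have [ik ci] := activeP fit acti.
  have [pW pndW] := pendantsP fit ik pnd.
  have szW' : size (map nu W) <= 4 by rewrite size_map.
  have dg : 1 < deg D (x i) := leq_trans cnt (deg_count ik).
  have [r lr rW] := leaf_swap optD xD ik ci dg pndW szW'.
  apply/negP; apply: IH (fits_rcons fit iends lr _ _) => //.
  move=> u v; rewrite mem_cat => /orP[/mapP[w wW [-> ->]]|]; last by left.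
  by right; split=> //; [apply: pW | apply: rW; apply: map_f].
- apply/negP=> /and4P[pu pv ok0 ok1].
  set u := (k + size tags).-1 in pu ok0 ok1 *.
  case: (boolP (edge (nu u) (nu v))) => uv.
    move: ok1; apply/negP; apply: (IH1 _ _ _ nu).
    case: fit => f1 f2 f3 f4 f5; split=> // a b.
    by rewrite inE => /predU1P[[-> ->]|/f4].
  move: ok0; apply/negP; apply: (IH0 _ _ _ nu).
  case: fit => f1 f2 f3 f4 f5; split=> // a b.
  by rewrite inE => /predU1P[[-> ->]|/f5].
Qed.

Lemma no_core c : check c [::] [::] [::] -> False.
Proof.
apply/negP; apply: (@check_sound _ _ _ _ x); split=> //.
  by move=> u; rewrite /private addn0; lia.
by move=> u; rewrite /private addn0; lia.
Qed.

End Checker.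

(** * Certificates for the five cores *)

Section Certificates.
Local Notation C := Copy.
Local Notation P := PathOrCycle.
Local Notation L := Leaf.
Local Notation W := Swap.
Local Notation B := Branch.

Definition P5_cert :=
  L 0 (L 4 (P [:: 6; 4; 3; 2; 1; 0; 5])).

Definition C5_cert :=
  L 0 (L 1 (B 5 (L 3 (B 5 (B 6 (L 2 (B 6 (B 7 (B 5 (L 4 (B 5 (B 7 (B 6 (B 8 (C 2 [::
  4; 0; 1; 2; 3; 9; 5; 6; 8; 7]) (W 2 [:: 9] (B 8 (P [:: 10; 2; 8; 9; 4; 0; 5]) (P [::
  10; 8; 9; 4; 0; 1; 6])))) (B 8 (W 1 [:: 9] (B 6 (P [:: 10; 1; 6; 9; 4; 3; 7]) (P [::
  10; 6; 9; 4; 3; 2; 8]))) (W 1 [:: 9] (B 5 (B 8 (B 7 (B 6 (C 0 [:: 10; 1; 6; 9; 4; 3; 7]) (C 0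
  [:: 10; 6; 9; 8; 2; 3; 7])) (C 0 [:: 1; 10; 7; 3; 4; 9; 8])) (C 0 [:: 10; 8; 2; 3; 4; 0; 5])) (C
  0 [:: 5; 10; 1; 2; 3; 4; 9]))))) (C 0 [:: 9; 7; 3; 2; 1; 0; 5])) (P [:: 9; 5; 0; 1; 2; 3; 7])))
  (W 0 [:: 5; 8] (P [:: 9; 0; 5; 8; 2; 3; 7]))) (C 0 [:: 8; 7; 3; 4; 0; 1; 6])) (P [::
  8; 6; 1; 0; 4; 3; 7]))) (W 3 [:: 7; 6] (P [:: 8; 3; 7; 6; 1; 0; 5]))) (B 6 (W 3 [:: 7; 5] (P [::
  8; 3; 7; 5; 0; 1; 6])) (W 0 [:: 5; 7] (B 6 (W 3 [:: 7; 6] (P [:: 9; 3; 7; 6; 1; 0; 8])) (W 3 [::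
  7; 6] (B 8 (B 5 (W 1 [:: 8; 5] (B 6 (B 9 (B 7 (C 0 [:: 10; 1; 0; 5; 7; 3; 9]) (C 0 [::
  8; 0; 1; 10; 7; 3; 9])) (C 0 [:: 10; 9; 3; 4; 0; 8; 6])) (C 0 [:: 10; 6; 8; 0; 4; 3; 2]))) (C 0
  [:: 5; 9; 3; 2; 1; 6; 8])) (C 3 [:: 8; 0; 1; 6; 9; 4; 2; 7])))))))) (L 2 (B 5 (P [::
  7; 2; 3; 4; 0; 5; 6]) (W 2 [:: 5] (P [:: 8; 2; 3; 4; 0; 5; 6])))))).

Definition H1_cert :=
  L 1 (L 4 (B 5 (L 2 (B 5 (B 6 (C 4 [:: 0; 2; 1; 3; 4; 7; 5; 6]) (C 0 [:: 7; 6; 4; 3; 0; 1; 5]))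
  (P [:: 7; 5; 1; 0; 3; 4; 6]))) (W 1 [:: 6] (B 5 (L 2 (B 6 (P [:: 8; 2; 0; 3; 4; 6; 5]) (P [::
  8; 6; 4; 3; 0; 1; 7]))) (C 0 [:: 7; 5; 6; 4; 3; 0; 2]))))).

Definition H2_cert :=
  L 1 (L 2 (B 5 (L 3 (B 5 (B 6 (L 4 (B 5 (B 6 (B 7 (C 5 [:: 0; 4; 3; 1; 2; 8; 7; 5; 6]) (C 4 [::
  0; 1; 2; 4; 8; 5; 6; 7])) (C 0 [:: 3; 4; 8; 6; 2; 1; 5])) (W 4 [:: 5] (B 6 (B 7 (C 5 [::
  0; 4; 3; 1; 2; 9; 7; 5; 6]) (C 4 [:: 0; 1; 2; 4; 9; 5; 6; 7])) (C 0 [::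
  3; 4; 9; 6; 2; 1; 5]))))) (C 0 [:: 4; 3; 7; 6; 2; 1; 5])) (B 6 (C 0 [:: 4; 3; 7; 5; 1; 2; 6]) (W
  1 [:: 5; 7] (W 2 [:: 8; 5] (B 7 (C 0 [:: 9; 2; 1; 5; 7; 3; 4]) (C 0 [::
  8; 1; 2; 9; 7; 3; 4]))))))) (W 1 [:: 5; 6] (W 2 [:: 7; 6; 5] (L 3 (B 5 (B 8 (B 7 (B 6 (L 4 (B 5
  (B 8 (B 9 (C 5 [:: 0; 4; 3; 1; 2; 10; 9; 5; 8]) (C 4 [:: 0; 1; 2; 4; 10; 5; 8; 9])) (C 0 [::
  3; 4; 10; 8; 2; 1; 5])) (W 4 [:: 5] (B 8 (B 9 (C 5 [:: 0; 4; 3; 1; 2; 11; 9; 5; 8]) (C 4 [::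
  0; 1; 2; 4; 11; 5; 8; 9])) (C 0 [:: 3; 4; 11; 8; 2; 1; 5]))))) (C 0 [:: 4; 3; 9; 6; 2; 1; 7]))
  (C 0 [:: 4; 3; 9; 7; 1; 2; 8])) (C 0 [:: 4; 3; 9; 8; 2; 1; 5])) (B 8 (C 0 [::
  4; 3; 9; 5; 1; 2; 8]) (B 7 (C 0 [:: 4; 3; 9; 8; 2; 1; 7]) (B 6 (C 0 [:: 7; 9; 5; 6; 2; 0; 4]) (W
  1 [:: 7; 5; 9] (W 2 [:: 10; 5] (B 9 (C 0 [:: 11; 2; 1; 5; 9; 3; 4]) (C 0 [::
  10; 1; 2; 11; 9; 3; 4]))))))))))))).

Definition C4_cert :=
  L 2 (L 0 (B 4 (L 1 (B 4 (B 5 (L 3 (B 5 (B 4 (B 6 (C 3 [:: 3; 0; 1; 2; 7; 5; 6; 4]) (W 1 [::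
  6; 7] (B 5 (B 4 (C 3 [:: 1; 0; 3; 2; 8; 5; 7; 4]) (W 1 [:: 7; 4] (B 5 (C 3 [::
  1; 0; 3; 2; 9; 5; 7; 4]) (P [:: 9; 5; 0; 3; 2; 4; 8])))) (B 4 (W 1 [:: 7; 5] (B 4 (C 3 [::
  1; 0; 3; 2; 9; 5; 7; 4]) (P [:: 9; 4; 2; 3; 0; 5; 8]))) (C 0 [:: 4; 8; 5; 0; 3; 7; 6]))))) (B 6
  (W 3 [:: 7; 4] (B 5 (B 6 (C 3 [:: 3; 0; 1; 2; 8; 5; 6; 4]) (W 1 [:: 6; 8; 7] (P [::
  9; 1; 6; 8; 3; 7; 4]))) (C 0 [:: 8; 5; 0; 1; 2; 4; 7]))) (W 3 [:: 6; 4] (B 5 (C 3 [::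
  3; 0; 1; 2; 8; 5; 6; 4]) (P [:: 8; 5; 0; 1; 2; 4; 7]))))) (B 4 (B 6 (W 3 [:: 7; 5] (B 4 (B 6 (C
  3 [:: 3; 0; 1; 2; 8; 5; 6; 4]) (W 1 [:: 6; 8; 7] (P [:: 9; 1; 6; 8; 3; 7; 5]))) (C 0 [::
  8; 4; 2; 1; 0; 5; 7]))) (W 3 [:: 6; 5] (B 4 (C 3 [:: 3; 0; 1; 2; 8; 5; 6; 4]) (P [::
  8; 4; 2; 1; 0; 5; 7])))) (B 6 (W 3 [:: 7; 4] (B 6 (B 5 (C 3 [:: 3; 0; 1; 2; 8; 5; 6; 4]) (C 0
  [:: 8; 5; 7; 4; 2; 1; 6])) (P [:: 5; 7; 4; 2; 1; 6; 8]))) (W 3 [:: 6; 5; 4] (C 3 [::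
  3; 0; 1; 2; 8; 5; 6; 4])))))) (W 1 [:: 5] (B 6 (B 4 (L 3 (B 4 (B 5 (B 7 (C 3 [::
  3; 0; 1; 2; 8; 5; 7; 4]) (W 1 [:: 8; 5] (B 4 (C 3 [:: 1; 0; 3; 2; 9; 5; 8; 4]) (P [::
  9; 4; 2; 3; 0; 5; 6])))) (W 3 [:: 7; 5] (B 4 (C 3 [:: 3; 0; 1; 2; 9; 5; 7; 4]) (P [::
  9; 4; 2; 1; 0; 5; 8])))) (W 3 [:: 7; 5; 4] (C 3 [:: 3; 0; 1; 2; 9; 5; 7; 4])))) (C 0 [::
  7; 4; 2; 3; 0; 5; 6])) (P [:: 7; 6; 5; 0; 3; 2; 4])))) (B 5 (W 1 [:: 4] (B 5 (B 6 (L 3 (B 5 (B 4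
  (B 7 (C 3 [:: 3; 0; 1; 2; 8; 5; 7; 4]) (W 1 [:: 8; 4] (B 5 (C 3 [:: 1; 0; 3; 2; 9; 5; 8; 4]) (P
  [:: 9; 5; 0; 3; 2; 4; 6])))) (W 3 [:: 7; 4] (B 5 (C 3 [:: 3; 0; 1; 2; 9; 5; 7; 4]) (P [::
  9; 5; 0; 1; 2; 4; 8])))) (W 3 [:: 7; 5; 4] (C 3 [:: 3; 0; 1; 2; 9; 5; 7; 4])))) (C 0 [::
  7; 6; 4; 2; 3; 0; 5])) (P [:: 7; 5; 0; 3; 2; 4; 6]))) (W 1 [:: 6; 4] (B 5 (W 0 [:: 7; 5; 6] (B 4
  (W 2 [:: 7; 4; 6] (B 5 (P [:: 9; 2; 4; 6; 5; 0; 8]) (C 3 [:: 5; 0; 1; 6; 9; 3; 7; 4]))) (C 3 [::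
  4; 2; 1; 6; 8; 3; 7; 5]))) (W 1 [:: 6; 5] (B 7 (B 4 (W 2 [:: 8; 7; 4; 6] (B 5 (W 0 [:: 8; 5; 6]
  (B 4 (P [:: 10; 0; 5; 6; 4; 2; 9]) (C 3 [:: 4; 2; 1; 6; 10; 3; 8; 5]))) (C 3 [::
  5; 0; 1; 6; 9; 3; 8; 4]))) (C 0 [:: 8; 4; 2; 3; 0; 5; 7])) (P [:: 8; 7; 5; 0; 3; 2; 4]))))))))
  (W 0 [:: 5; 4] (W 2 [:: 6; 4; 5] (L 1 (B 7 (B 4 (B 5 (B 6 (L 3 (B 5 (B 7 (B 8 (C 3 [::
  3; 0; 1; 2; 9; 5; 8; 7]) (B 4 (B 6 (W 1 [:: 9; 4] (B 6 (C 3 [:: 1; 0; 3; 2; 10; 6; 9; 4]) (B 5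
  (P [:: 10; 6; 0; 5; 4; 2; 7]) (C 0 [:: 6; 10; 5; 4; 2; 3; 9])))) (C 0 [:: 9; 6; 0; 5; 4; 2; 7]))
  (B 6 (W 1 [:: 9; 5] (B 7 (C 3 [:: 1; 0; 3; 2; 10; 5; 9; 7]) (B 6 (B 4 (C 0 [::
  10; 7; 2; 4; 5; 0; 6]) (C 0 [:: 7; 10; 4; 9; 3; 0; 6])) (B 8 (C 0 [:: 6; 10; 7; 2; 3; 9; 8]) (C
  0 [:: 7; 10; 8; 9; 3; 0; 5]))))) (W 1 [:: 9; 7] (B 5 (C 3 [:: 1; 0; 3; 2; 10; 5; 9; 7]) (B 6 (C
  0 [:: 5; 10; 1; 2; 3; 9; 6]) (C 0 [:: 5; 10; 6; 9; 3; 2; 7]))))))) (B 4 (P [::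
  9; 7; 2; 4; 5; 0; 6]) (B 8 (C 0 [:: 7; 9; 4; 5; 0; 1; 8]) (B 6 (W 3 [:: 7; 4] (B 6 (B 8 (C 3 [::
  3; 0; 1; 2; 10; 6; 8; 4]) (B 9 (B 5 (C 0 [:: 10; 8; 9; 4; 5; 0; 6]) (C 0 [::
  10; 5; 0; 1; 2; 7; 9])) (C 0 [:: 10; 9; 4; 2; 1; 0; 6]))) (P [:: 10; 6; 0; 1; 2; 4; 9]))) (W 3
  [:: 7; 4] (B 5 (B 9 (B 6 (C 3 [:: 3; 2; 4; 9; 10; 1; 5; 6]) (C 0 [:: 10; 6; 0; 5; 4; 2; 7])) (C
  0 [:: 10; 9; 7; 2; 1; 0; 5])) (P [:: 10; 5; 0; 1; 2; 7; 9]))))))) (B 8 (B 4 (B 6 (C 3 [::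
  3; 0; 1; 2; 9; 6; 8; 4]) (C 0 [:: 6; 9; 5; 4; 2; 1; 8])) (B 6 (W 2 [:: 9; 6] (B 8 (C 3 [::
  2; 1; 0; 3; 10; 8; 6; 9]) (P [:: 10; 8; 1; 0; 3; 9; 4]))) (W 3 [:: 9; 4] (B 6 (B 8 (C 3 [::
  3; 0; 1; 2; 10; 6; 8; 4]) (C 0 [:: 10; 8; 1; 0; 6; 9; 4])) (P [:: 10; 6; 9; 4; 2; 1; 8]))))) (W
  3 [:: 8; 4] (B 6 (C 3 [:: 3; 0; 1; 2; 10; 6; 8; 4]) (B 5 (P [:: 10; 6; 0; 5; 4; 2; 7]) (C 0 [::
  6; 10; 5; 4; 2; 1; 8]))))))) (C 0 [:: 8; 6; 0; 5; 4; 2; 7])) (B 6 (L 3 (B 6 (B 8 (B 7 (C 3 [::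
  3; 0; 1; 2; 9; 6; 8; 7]) (W 2 [:: 9; 6] (B 8 (C 3 [:: 2; 1; 0; 3; 10; 8; 6; 9]) (P [::
  10; 8; 1; 0; 3; 9; 7])))) (B 5 (B 7 (W 1 [:: 9; 5] (B 7 (C 3 [:: 1; 0; 3; 2; 10; 5; 9; 7]) (P
  [:: 10; 7; 2; 3; 0; 5; 8]))) (C 0 [:: 2; 7; 9; 8; 5; 0; 6])) (B 4 (B 7 (W 1 [:: 9; 4] (B 6 (C 3
  [:: 1; 0; 3; 2; 10; 6; 9; 4]) (B 5 (C 0 [:: 6; 10; 1; 2; 3; 9; 5]) (B 8 (B 7 (C 0 [::
  6; 10; 5; 9; 3; 2; 7]) (C 0 [:: 6; 10; 7; 2; 3; 9; 8])) (C 0 [:: 6; 10; 8; 9; 3; 2; 4]))))) (W 1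
  [:: 9; 6] (B 4 (C 3 [:: 1; 0; 3; 2; 10; 6; 9; 4]) (B 7 (C 0 [:: 4; 10; 1; 0; 3; 9; 7]) (C 0 [::
  4; 10; 7; 9; 3; 0; 6]))))) (W 3 [:: 8; 4] (B 6 (C 3 [:: 3; 0; 1; 2; 10; 6; 8; 4]) (P [::
  10; 6; 0; 1; 2; 4; 9])))))) (W 3 [:: 8; 7] (B 6 (C 3 [:: 3; 0; 1; 2; 10; 6; 8; 7]) (B 5 (C 0 [::
  6; 10; 3; 2; 1; 8; 5]) (C 0 [:: 6; 10; 5; 8; 1; 2; 7])))))) (W 0 [:: 6; 5; 8; 7] (B 4 (L 3 (B 8
  (B 9 (B 7 (C 3 [:: 3; 0; 1; 2; 10; 9; 8; 7]) (W 2 [:: 10; 9] (B 8 (C 3 [::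
  2; 1; 0; 3; 11; 8; 9; 10]) (P [:: 11; 8; 1; 0; 3; 10; 7])))) (W 3 [:: 8; 4] (B 9 (C 3 [::
  3; 0; 1; 2; 11; 9; 8; 4]) (B 6 (C 0 [:: 9; 11; 3; 2; 1; 8; 6]) (C 0 [::
  9; 11; 6; 8; 1; 2; 4]))))) (W 3 [:: 8; 4] (B 9 (C 3 [:: 3; 0; 1; 2; 11; 9; 8; 4]) (B 6 (C 0 [::
  9; 11; 3; 2; 1; 8; 6]) (C 0 [:: 9; 11; 6; 8; 1; 2; 4])))))) (C 0 [:: 8; 6; 0; 9; 4; 2; 7])))))
  (B 6 (B 5 (L 3 (B 8 (B 7 (B 5 (C 3 [:: 3; 0; 1; 2; 9; 5; 8; 7]) (W 0 [:: 9; 7] (B 8 (C 3 [::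
  0; 1; 2; 3; 10; 8; 7; 9]) (P [:: 10; 8; 1; 2; 3; 9; 5])))) (B 4 (C 0 [:: 7; 9; 3; 0; 1; 8; 4])
  (B 6 (C 0 [:: 7; 9; 4; 8; 1; 0; 6]) (B 5 (W 2 [:: 9; 5] (B 8 (C 3 [:: 2; 1; 0; 3; 10; 8; 5; 9])
  (P [:: 10; 8; 1; 0; 3; 9; 7]))) (W 3 [:: 9; 5] (B 7 (B 8 (C 3 [:: 3; 0; 1; 2; 10; 5; 8; 7]) (C 0
  [:: 10; 8; 1; 0; 5; 9; 7])) (P [:: 10; 7; 9; 5; 0; 1; 8]))))))) (W 3 [:: 8; 6] (B 7 (C 3 [::
  3; 0; 1; 2; 10; 6; 8; 7]) (B 4 (C 0 [:: 7; 10; 3; 0; 1; 8; 4]) (C 0 [::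
  7; 10; 4; 8; 1; 0; 6])))))) (L 3 (B 8 (B 6 (B 7 (C 3 [:: 3; 0; 1; 2; 9; 6; 8; 7]) (B 4 (C 0 [::
  7; 9; 3; 0; 1; 8; 4]) (C 0 [:: 7; 9; 4; 8; 1; 0; 6]))) (W 3 [:: 8; 6] (B 7 (C 3 [::
  3; 0; 1; 2; 10; 6; 8; 7]) (B 4 (C 0 [:: 7; 10; 3; 0; 1; 8; 4]) (C 0 [::
  7; 10; 4; 8; 1; 0; 6]))))) (W 3 [:: 8; 6] (B 7 (C 3 [:: 3; 0; 1; 2; 10; 6; 8; 7]) (B 4 (C 0 [::
  7; 10; 3; 0; 1; 8; 4]) (C 0 [:: 7; 10; 4; 8; 1; 0; 6]))))))) (B 5 (W 1 [:: 7; 6; 4] (B 8 (W 0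
  [:: 9; 6; 8] (B 4 (P [:: 10; 0; 6; 8; 4; 2; 7]) (C 3 [:: 4; 2; 1; 8; 10; 3; 9; 6]))) (C 0 [::
  9; 8; 6; 0; 3; 2; 7]))) (W 1 [:: 6; 4] (B 7 (B 8 (W 0 [:: 9; 6; 8] (B 4 (P [::
  10; 0; 6; 8; 4; 2; 7]) (C 3 [:: 4; 2; 1; 8; 10; 3; 9; 6]))) (C 0 [:: 9; 8; 6; 0; 3; 2; 7])) (P
  [:: 9; 7; 2; 3; 0; 6; 8])))))) (B 4 (B 5 (P [:: 8; 7; 2; 4; 5; 0; 6]) (B 6 (W 1 [:: 7; 6; 5] (B
  8 (W 2 [:: 9; 7; 8] (B 5 (P [:: 10; 2; 7; 8; 5; 0; 6]) (C 3 [:: 5; 0; 1; 8; 10; 3; 9; 7]))) (C 0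
  [:: 9; 8; 7; 2; 3; 0; 6]))) (W 1 [:: 6; 5] (B 4 (B 8 (B 7 (C 3 [:: 1; 0; 5; 8; 9; 3; 4; 7]) (C 0
  [:: 9; 7; 2; 4; 5; 0; 6])) (C 0 [:: 9; 8; 6; 0; 3; 2; 4])) (P [:: 9; 4; 2; 3; 0; 6; 8]))))) (B 6
  (B 5 (W 1 [:: 7; 4] (B 6 (B 8 (B 5 (W 2 [:: 9; 7; 4; 8] (B 6 (B 5 (L 3 (B 8 (B 10 (B 5 (C 3 [::
  3; 0; 1; 2; 11; 5; 8; 10]) (W 0 [:: 11; 10] (B 8 (C 3 [:: 0; 1; 2; 3; 12; 8; 10; 11]) (P [::
  12; 8; 1; 2; 3; 11; 5])))) (W 3 [:: 9; 4] (B 6 (C 3 [:: 3; 0; 1; 2; 12; 6; 9; 4]) (B 5 (P [::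
  12; 6; 0; 5; 4; 2; 7]) (C 0 [:: 6; 12; 5; 4; 2; 1; 9]))))) (W 3 [:: 9; 4] (B 6 (C 3 [::
  3; 0; 1; 2; 12; 6; 9; 4]) (B 5 (P [:: 12; 6; 0; 5; 4; 2; 7]) (C 0 [::
  6; 12; 5; 4; 2; 1; 9])))))) (C 0 [:: 8; 7; 2; 10; 5; 0; 6])) (B 5 (C 0 [::
  10; 6; 0; 5; 4; 8; 7]) (C 0 [:: 6; 10; 5; 4; 8; 1; 9])))) (C 0 [:: 9; 5; 0; 3; 2; 7; 8])) (C 0
  [:: 9; 8; 4; 2; 3; 0; 6])) (P [:: 9; 6; 0; 3; 2; 4; 8]))) (W 1 [:: 7; 6; 5] (B 8 (W 2 [::
  9; 7; 8] (B 5 (P [:: 10; 2; 7; 8; 5; 0; 6]) (C 3 [:: 5; 0; 1; 8; 10; 3; 9; 7]))) (C 0 [::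
  9; 8; 7; 2; 3; 0; 6])))) (B 5 (W 1 [:: 7; 4] (B 8 (B 5 (B 6 (C 3 [:: 1; 2; 4; 8; 9; 3; 5; 6]) (C
  0 [:: 9; 6; 0; 5; 4; 2; 7])) (C 0 [:: 9; 5; 0; 3; 2; 7; 8])) (P [:: 9; 8; 7; 2; 3; 0; 5]))) (W 2
  [:: 7; 4; 8] (B 5 (B 6 (W 1 [:: 9; 7; 6; 4] (B 8 (B 5 (W 0 [:: 10; 5; 8] (B 7 (P [::
  11; 0; 5; 8; 7; 2; 9]) (C 3 [:: 7; 2; 1; 8; 11; 3; 10; 5]))) (W 0 [:: 10; 8] (B 6 (B 4 (P [::
  11; 0; 6; 8; 4; 2; 9]) (C 3 [:: 4; 2; 1; 8; 11; 3; 10; 6])) (B 5 (B 7 (P [::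
  11; 0; 5; 8; 7; 2; 9]) (C 0 [:: 6; 11; 7; 2; 1; 10; 5])) (C 0 [:: 6; 11; 5; 10; 1; 2; 3]))))) (C
  0 [:: 10; 8; 6; 0; 3; 2; 9]))) (W 1 [:: 6; 5] (B 9 (B 8 (B 7 (C 3 [:: 1; 0; 6; 8; 10; 3; 9; 7])
  (C 0 [:: 10; 7; 2; 9; 6; 0; 5])) (C 0 [:: 10; 8; 5; 0; 3; 2; 9])) (P [::
  10; 9; 2; 3; 0; 5; 8])))) (B 6 (W 1 [:: 6; 5] (B 9 (B 8 (B 7 (C 3 [:: 1; 0; 5; 8; 10; 3; 9; 7])
  (C 0 [:: 10; 7; 2; 9; 5; 0; 6])) (C 0 [:: 10; 8; 6; 0; 3; 2; 9])) (P [::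
  10; 9; 2; 3; 0; 6; 8]))) (W 1 [:: 9; 8; 4] (B 6 (C 3 [:: 1; 0; 6; 8; 10; 3; 9; 4]) (B 5 (P [::
  10; 6; 0; 5; 4; 2; 7]) (B 7 (W 1 [:: 10; 8; 5] (B 7 (B 9 (C 3 [:: 1; 0; 5; 8; 11; 3; 9; 7]) (B 6
  (B 4 (W 0 [:: 10; 9; 7; 4] (B 11 (B 8 (B 6 (W 2 [:: 11; 4; 8] (B 6 (P [::
  13; 2; 4; 8; 6; 0; 12]) (C 3 [:: 6; 0; 1; 8; 13; 3; 11; 4]))) (B 5 (C 0 [::
  12; 6; 10; 5; 4; 2; 3]) (C 0 [:: 6; 12; 5; 4; 2; 1; 11]))) (C 0 [:: 0; 12; 8; 4; 2; 9; 11])) (B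
  5 (C 0 [:: 11; 12; 0; 5; 4; 2; 7]) (C 4 [:: 0; 12; 5; 3; 2; 11; 10; 7])))) (C 0 [::
  11; 4; 2; 3; 0; 6; 10])) (B 4 (C 0 [:: 11; 6; 0; 5; 4; 2; 7]) (W 0 [:: 10; 4] (B 11 (B 6 (P [::
  12; 0; 6; 11; 4; 2; 7]) (B 5 (C 0 [:: 12; 6; 10; 5; 4; 2; 3]) (C 0 [:: 5; 12; 6; 11; 1; 2; 3])))
  (B 7 (B 5 (B 8 (C 0 [:: 11; 12; 0; 3; 2; 7; 8]) (C 3 [:: 12; 0; 5; 8; 11; 3; 10; 7])) (C 4 [::
  0; 12; 5; 3; 2; 11; 10; 7])) (C 3 [:: 12; 0; 1; 11; 7; 3; 10; 4]))))))) (C 0 [::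
  11; 7; 2; 3; 0; 5; 10]))) (W 1 [:: 6; 5] (B 4 (B 7 (B 10 (C 3 [:: 1; 0; 5; 10; 11; 3; 4; 7]) (C
  0 [:: 11; 10; 6; 0; 3; 2; 4])) (C 0 [:: 11; 7; 2; 4; 5; 0; 6])) (P [::
  11; 4; 2; 3; 0; 6; 10]))))))))))))))))))).

End Certificates.

Definition P5_ends := [:: (0, [:: 4; 3; 2; 1]); (4, [:: 0; 1; 2; 3])].
(** No vertex of a cycle is a cut vertex; the rotation lists the path left by [i], from its
    successor round to its predecessor. *)
Definition cycle_ends n := [seq (i, behead (rot i (iota 0 n))) | i <- iota 0 n].
Definition H1_ends := [:: (1, [:: 4; 3; 2; 0]); (2, [:: 4; 3; 1; 0]); (4, [:: 3; 2; 1; 0])].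
Definition H2_ends :=
  [:: (1, [:: 4; 3; 2; 0]); (2, [:: 4; 3; 1; 0]); (3, [:: 4; 2; 1; 0]); (4, [:: 3; 2; 1; 0])].

(** * Recognition of split graphs *)

Definition has_core (G : sgraph) k es :=
  exists x : nat -> G,
    (forall i j, i < k -> j < k -> x i = x j -> i = j) /\
    (forall i j, i < k -> j < k -> edge (x i) (x j) = adj es i j).

Definition twin_free (P : seq nat * seq (nat * nat)) :=
  all (fun i => all (fun j => (i == j) || has (fun l => adj P.2 i l != adj P.2 j l) P.1) P.1) P.1.

(** Two vertices with the same image would have the same neighbours in the pattern. *)
Lemma realizes_inj (G : sgraph) P (e : nat -> G) :
  twin_free P -> realizes P e -> {in P.1 &, injective e}.
Proof.
move=> /allP tf re i j iP jP eij; have /allP/(_ j jP) := tf i iP.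
case/orP=> [/eqP//|/hasP[l lP]]; rewrite -!re // eij.
by rewrite eqxx.
Qed.

Definition pairs k := [seq (i, j) | j <- iota 0 k, i <- iota 0 j].

(** [C_4] has twins, hence the alternative [uniq s]. *)
Lemma core_of_seq (G : sgraph) es (x0 : G) (s : seq G) :
  twin_free (iota 0 (size s), es) || uniq s ->
  [seq edge (nth x0 s p.1) (nth x0 s p.2) | p <- pairs (size s)] =
    [seq adj es p.1 p.2 | p <- pairs (size s)] ->
  has_core G (size s) es.
Proof.
move=> inj /eq_in_map E.
have re : realizes (iota 0 (size s), es) (nth x0 s).
  have lt i j : i < j < size s -> edge (nth x0 s i) (nth x0 s j) = adj es i j.
    case/andP=> ij js; apply: (E (i, j)).
    by apply/allpairsPdep; exists j, i; rewrite !mem_iota.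
  move=> i j; rewrite !mem_iota /= => ik jk.
  case: (ltngtP i j) => [ij|ji|->]; first by rewrite lt // ij.
    by rewrite edge_sym adj_sym lt // ji.
  by rewrite edge_irrefl /adj eqxx.
exists (nth x0 s); split=> i j ik jk; last by apply: re; rewrite mem_iota.
case/orP: inj => [tf|us]; last by move/eqP; rewrite nth_uniq // => /eqP.
by apply: (realizes_inj tf re); rewrite mem_iota.
Qed.

Section SplitRecognition.
Variable H : sgraph.
Implicit Types (K : {set H}) (a b c d e u v w x y z : H).

Lemma edge_neq x y : edge x y -> x != y.
Proof. by apply: contraTneq => ->; rewrite edge_irrefl. Qed.

Hypothesis no2K2 : forall a b c d, edge a b -> edge c d ->
  ~~ edge a c -> ~~ edge a d -> ~~ edge b c -> ~~ edge b d -> False.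
Hypothesis noC4 : forall a b c d, a != c -> b != d ->
  edge a b -> edge b c -> edge c d -> edge d a -> ~~ edge a c -> ~~ edge b d -> False.
Hypothesis noC5 : forall a b c d e,
  edge a b -> edge b c -> edge c d -> edge d e -> edge e a ->
  ~~ edge a c -> ~~ edge a d -> ~~ edge b d -> ~~ edge b e -> ~~ edge c e -> False.

Definition cliqueb K := [forall x in K, forall y in K, (x != y) ==> edge x y].

Lemma cliqueP K : reflect (clique K) (cliqueb K).
Proof.
apply: (iffP forall_inP) => [cK x y xK yK xy | cK x xK].
  by have /forall_inP/(_ y yK)/implyP := cK x xK; apply.
by apply/forall_inP=> y yK; apply/implyP; apply: cK.
Qed.

Lemma clique_add K u : clique K -> {in K, forall x, edge u x} -> clique (u |: K).
Proof.
move=> cK uK x y /setU1P[->|xK] /setU1P[->|yK]; rewrite ?eqxx // => xy.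
- exact: uK.
- by rewrite edge_sym uK.
- exact: cK.
Qed.

Lemma cliqueS K K' : K' \subset K -> clique K -> clique K'.
Proof. by move=> sK cK x y /(subsetP sK) xK /(subsetP sK) yK; apply: cK. Qed.

(* Foldes and Hammer: take a clique [K] of maximum size and, subject to this,
   with as few edges as possible outside [K]. *)
Lemma split_graph_of_free : split_graph H.
Proof.
pose out K := \sum_(u in ~: K) deg (~: K) u.
have c0 : cliqueb set0 by apply/cliqueP=> x y; rewrite inE.
have [K1 cK1 maxK1] := arg_maxnP (fun K => #|K|) c0.
have c1 : cliqueb K1 && (#|K1| == #|K1|) by rewrite cK1 eqxx.
have [K /andP[/cliqueP cK /eqP sK] minK] :=
  arg_minnP (P := fun K => cliqueb K && (#|K| == #|K1|)) out c1.
have {maxK1} maxK K' : clique K' -> #|K'| <= #|K|.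
  by move/cliqueP=> cK'; rewrite sK; apply: maxK1.
have {minK} minK K' : clique K' -> #|K'| = #|K| -> out K <= out K'.
  by move=> /cliqueP cK' sK'; apply: minK; rewrite cK' sK' sK eqxx.
have nonadj u : u \notin K -> exists2 z, z \in K & ~~ edge u z.
  move=> uK; case: (boolP [exists z in K, ~~ edge u z]) => [/exists_inP|/exists_inPn uall].
    by case=> z zK uz; exists z.
  have /maxK : clique (u |: K) by apply: clique_add => // x /uall; rewrite negbK.
  by rewrite cardsU1 uK; lia.
have ncl u z : u \notin K -> z \in K -> u != z.
  by move=> uK; apply: contraTneq => <-.
(* Let [z] be missed by both ends of an edge [u v] outside [K], and let [v] miss [y] as well. Then
   [u] sees all of [K] except [z], so exchanging [z] for [u] gives another maximum clique; the
   minimality of [out K] then leads to a [C_4] or a [C_5]. *)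
have step u v z y : u \notin K -> v \notin K -> edge u v -> z \in K -> y \in K ->
    y != z -> ~~ edge u z -> ~~ edge v z -> ~~ edge v y -> False.
  move=> uK vK uv zK yK yz uz vz vy.
  have zy : edge z y by apply: cK => //; rewrite eq_sym.
  have common t : t \in K -> t != z -> edge u t || edge v t.
    move=> tK tz; case: (boolP (edge u t)) => // ut; case: (boolP (edge v t)) => // vt.
    by case: (no2K2 uv (cK _ _ tK zK tz) ut uz vt vz).
  have uy : edge u y by have := common y yK yz; rewrite (negbTE vy) orbF.
  have uall t : t \in K -> t != z -> edge u t.
    move=> tK tz; case: (boolP (edge u t)) => // ut.
    have vt : edge v t by have := common t tK tz; rewrite (negbTE ut).
    have ty : t != y by apply: contraTneq vt => ->.
    have yu : edge y u by rewrite edge_sym.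
    by case: (noC4 (ncl u t uK tK) (ncl v y vK yK) uv vt (cK _ _ tK yK ty) yu ut vy).
  pose K' := u |: (K :\ z).
  have cK' : clique K'.
    apply: clique_add => [|t]; first exact: cliqueS (subsetDl _ _) cK.
    by rewrite !inE => /andP[tz tK]; apply: uall.
  have sK' : #|K'| = #|K|.
    by rewrite cardsU1 !inE (negbTE uK) andbF (cardsD1 z K) zK.
  pose R := ~: (u |: K).
  have zR : z \notin R by rewrite !inE zK orbT.
  have uR : u \notin R by rewrite !inE eqxx.
  have outK : ~: K = u |: R.
    by apply/setP=> t; rewrite !inE; case: (t =P u) => [->|].
  have outK' : ~: K' = z |: R.
    apply/setP=> t; rewrite !inE; case: (t =P z) => [->|] //=.
    by rewrite orbF eq_sym ncl.
  have := minK K' cK' sK'; rewrite /out outK outK' => le_out.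
  (* [weight_add] acts here as a formula for degree sums: both sets extend [R] by one vertex and
     have complements of the same size. *)
  have := weight_add uR; have := weight_add zR; rewrite /weight.
  have -> : #|~: (u |: R)| = #|~: (z |: R)| by rewrite -outK -outK' !setCK sK'.
  move: le_out; set a := \sum_(_ in u |: R) _; set b := \sum_(_ in z |: R) _.
  set c := \sum_(_ in R) _; set m := #|~: (z |: R)|; set n := #|~: R|.
  move=> le_out wz wu; have degR : deg R u <= deg R z.
    by move: a b c m n (deg R u) (deg R z) le_out wz wu; clear; lia.
  clear a b c m n le_out wz wu.
  have vR : v \in [set t in R | edge u t].
    by rewrite !inE negb_or vK uv eq_sym (edge_neq uv).
  (* As [v] is adjacent to [u] but not to [z], the inequality of degrees forces a vertex with the
     opposite behaviour. *)
  have [w wz wu] : exists2 w, w \in [set t in R | edge z t] & ~~ edge u w.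
    apply/exists_inP; apply: contraLR degR => /exists_inPn Rz.
    rewrite -ltnNge; apply: proper_card; apply/properP; split.
      apply/subsetP=> t tz; have := Rz t tz; rewrite negbK => ut.
      by move: tz; rewrite !inE ut => /andP[->].
    by exists v => //; rewrite !inE edge_sym (negbTE vz) andbF.
  move: wz; rewrite !inE negb_or => /andP[/andP[wu' wK] zw].
  have vw : edge v w.
    case: (boolP (edge v w)) => // vw.
    by case: (no2K2 uv zw uz wu vz vw).
  have yu : edge y u by rewrite edge_sym.
  case: (boolP (edge w y)) => wy.
    by rewrite eq_sym in wu'; case: (noC4 wu' (ncl v y vK yK) uv vw wy yu wu vy).
  have wz : edge w z by rewrite edge_sym.
  exact: (noC5 uv vw wz zy yu wu uz vz vy wy).
exists (~: K), K; split=> //; first by rewrite setUC setUCr.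
  by rewrite -setI_eq0 setIC setICr.
move=> u v; rewrite !inE => uK vK; apply/negP=> uv.
have vu : edge v u by rewrite edge_sym.
(* Without a common non-neighbour in [K], a non-neighbour of [u] and one of [v] would close a
   [C_4]. *)
have [z zK [uz vz]] : exists2 z, z \in K & ~~ edge u z /\ ~~ edge v z.
  have [x xK ux] := nonadj u uK; have [y yK vy] := nonadj v vK.
  case: (boolP (edge v x)) => vx; last by exists x.
  case: (boolP (edge u y)) => uy; last by exists y.
  have xy : x != y by apply: contraTneq vx => ->.
  have yu : edge y u by rewrite edge_sym.
  by case: (noC4 (ncl u x uK xK) (ncl v y vK yK) uv vx (cK _ _ xK yK xy) yu ux vy).
case: (boolP [exists y in K :\ z, ~~ edge u y]) => [/exists_inP[y]|/exists_inPn uall].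
  by rewrite !inE => /andP[yz yK] uy; apply: (step v u z y).
case: (boolP [exists y in K :\ z, ~~ edge v y]) => [/exists_inP[y]|/exists_inPn vall].
  by rewrite !inE => /andP[yz yK] vy; apply: (step u v z y).
(* Both [u] and [v] see the rest of [K], so replacing [z] by the two of them enlarges a maximum
   clique. *)
have cK' : clique (u |: (v |: (K :\ z))).
  apply: clique_add => [|t].
    apply: clique_add => [|t /vall]; last by rewrite negbK.
    exact: cliqueS (subsetDl _ _) cK.
  by rewrite inE => /orP[/set1P->|/uall] //; rewrite negbK.
have := maxK _ cK'; rewrite !cardsU1 !inE (negbTE uK) (negbTE vK) !andbF orbF.
by rewrite (edge_neq uv) (cardsD1 z K) zK; lia.
Qed.

End SplitRecognition.

(** [A] is the set of vertices seeing neither [c] nor [d], and [X] its part with a neighbour in [A].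
    An edge [u v] leaving [X] also leaves [A], so [v] sees [c] or [d]. With a neighbour [w] of [u]
    in [A], the vertices [u], [w], [v], [c], [d] induce a core, which depends on whether [v] sees
    both ends of [u w] and both ends of [c d]. *)
Lemma has_core_induced_2K2 (H : sgraph) (a b c d : H) : connected H ->
  edge a b -> edge c d -> ~~ edge a c -> ~~ edge a d -> ~~ edge b c -> ~~ edge b d ->
  [\/ has_core H 5 (path_edges 5), has_core H 5 H1_edges | has_core H 5 H2_edges].
Proof.
case/connected_cut=> _ cut ab cd ac ad bc bd.
pose A := [set z | ~~ edge z c && ~~ edge z d].
pose X := [set z in A | [exists w in A, edge z w]].
have aX : a \in X by rewrite !inE ac ad /=; apply/exists_inP; exists b; rewrite ?inE ?bc.
have cX : c \notin X by rewrite !inE cd andbF.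
have [u [v [uX vX uv]]] := cut X a c aX cX.
move: uX; rewrite inE => /andP[uA /exists_inP[w wA uw]].
have {vX} vA : v \notin A.
  by apply: contra vX => vA; rewrite inE vA; apply/exists_inP; exists u; rewrite // edge_sym.
move: uA wA vA; rewrite !inE negb_and !negbK => /andP[uc ud] /andP[wc wd] vcd.
wlog vc : c d cd uc ud wc wd vcd {ac ad bc bd A X aX cX} / edge v c.
  move=> W; case/orP: (vcd) => [vc|vd]; first exact: (W c d).
  by apply: (W d c); rewrite // 1?orbC // edge_sym.
have [uv' ud' uc'] : [/\ edge v u, edge u d = false & edge u c = false].
  by rewrite edge_sym uv (negbTE uc) (negbTE ud).
have [vc' wd' wc'] : [/\ edge c v, edge w d = false & edge w c = false].
  by rewrite edge_sym vc (negbTE wc) (negbTE wd).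
have [cu' dw cw] : [/\ edge c u = false, edge d w = false & edge c w = false].
  by rewrite ![edge _ u]edge_sym ![edge _ w]edge_sym.
have du : edge d u = false by rewrite edge_sym.
case vw: (edge v w); case vd: (edge v d).
- by apply: Or33; apply: (core_of_seq (x0 := v) (s := [:: v; u; w; c; d])) => //=;
     rewrite uv' vw vc vd uw uc' ud' wc' wd' cd.
- by apply: Or32; apply: (core_of_seq (x0 := v) (s := [:: v; u; w; c; d])) => //=;
     rewrite uv' vw vc vd uw uc' ud' wc' wd' cd.
- by apply: Or32; apply: (core_of_seq (x0 := v) (s := [:: v; c; d; u; w])) => //=;
     rewrite uv' vw vc vd uw cu' du cw dw cd.
- apply: Or31; apply: (core_of_seq (x0 := v) (s := [:: w; u; v; c; d])) => //=.
  have [wu wv] : edge w u /\ edge w v = false by rewrite ![edge w _]edge_sym.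
  by rewrite wu wv uv wc' uc' vc wd' ud' vd cd.
Qed.

Definition cores := [:: (5, path_edges 5); (5, cycle_edges 5); (4, cycle_edges 4);
                        (5, H1_edges); (5, H2_edges)].

Lemma split_of_no_core (H : sgraph) : connected H ->
  (forall p, p \in cores -> ~ has_core H p.1 p.2) -> split_graph H.
Proof.
move=> cH none; have noc k es : (k, es) \in cores -> has_core H k es -> False.
  by move/none.
apply: split_graph_of_free.
- move=> a b c d ab cd ac ad bc bd.
  by case: (has_core_induced_2K2 cH ab cd ac ad bc bd); apply: noc.
- move=> a b c d ac bd ab bc cd da nac nbd.
  apply: (noc 4 (cycle_edges 4)) => //.
  apply: (core_of_seq (x0 := a) (s := [:: a; b; c; d])) => /=.
    rewrite !inE !negb_or ac bd (edge_neq ab) (edge_neq bc) (edge_neq cd).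
    by rewrite [a == d]eq_sym (edge_neq da).
  by rewrite ab (negbTE nac) bc [edge a d]edge_sym da (negbTE nbd) cd.
move=> a b c d e ab bc cd de ea nac nad nbd nbe nce.
apply: (noc 5 (cycle_edges 5)) => //.
apply: (core_of_seq (x0 := a) (s := [:: a; b; c; d; e])) => //=.
rewrite ab (negbTE nac) bc (negbTE nad) (negbTE nbd) cd [edge a e]edge_sym ea.
by rewrite (negbTE nbe) (negbTE nce) de.
Qed.

(** * The forbidden graphs *)

(** A numbering connects the graphs of the statement, whose vertices are ordinals or elements of
    sums, to the lists on which the checkers compute. *)
Definition represents (H : sgraph) (P : seq nat * seq (nat * nat)) (h : H -> nat) :=
  [/\ injective h, forall i, i \in P.1 <-> exists x, h x = i &
      forall x y, edge x y = adj P.2 (h x) (h y)].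

Lemma contains_realizes (G H : sgraph) P (h : H -> nat) :
  represents P h -> 0 \in P.1 -> contains_induced G H -> exists e, @realizes G P e.
Proof.
case=> h_inj hP hE /hP[x0 _] [A [f _ fE]].
(* The vertex [x0], numbered 0, is the default for numbers outside the pattern. *)
pose e i := val (f (odflt x0 [pick x | h x == i])).
have eh x : e (h x) = val (f x).
  rewrite /e; case: pickP => [y /eqP/h_inj->|/(_ x)] //.
  by rewrite eqxx.
exists e => i j /hP[x <-] /hP[y <-].
by rewrite !eh -hE -fE.
Qed.

Lemma realizes_contains (G H : sgraph) P (h : H -> nat) (e : nat -> G) :
  represents P h -> twin_free P -> realizes P e -> contains_induced G H.
Proof.
case=> h_inj hP hE tf re; have e_inj := realizes_inj tf re.
have hin x : h x \in P.1 by apply/hP; exists x.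
pose A := [set e (h x) | x : H].
have inA x : e (h x) \in A by apply: imset_f.
exists A; exists (fun x => Sub (e (h x)) (inA x) : induced A); last first.
  by move=> x y; rewrite hE -re.
apply: inj_card_bij.
  by move=> x y [] /(e_inj _ _ (hin x) (hin y)) /h_inj.
by rewrite card_sig; apply: leq_imset_card.
Qed.

Lemma represents_ord n (r : rel nat) es :
  all (fun i => all (fun j => ((i != j) && (r i j || r j i)) == adj es i j) (iota 0 n))
      (iota 0 n) ->
  represents (H := sym_graph [rel i j : 'I_n | r i j]) (iota 0 n, es) val.
Proof.
move=> /allP ok; split; first exact: val_inj.
  move=> i; rewrite mem_iota /=; split=> [i_n|[j <-]]; first by exists (Ordinal i_n).
  exact: ltn_ord.
have mem (i : 'I_n) : val i \in iota 0 n by rewrite mem_iota ltn_ord.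
move=> i j; have /allP/(_ _ (mem j))/eqP/= <- := ok _ (mem i).
by rewrite /= /sym_edge /= -val_eqE.
Qed.

Lemma represents_leaves (H : sgraph) n es (A : seq nat) (B : {set H}) (h : H -> nat) :
  represents (iota 0 n, es) h -> all (fun p => (p.1 < n) && (p.2 < n)) es ->
  all (ltn^~ n) A -> (forall u, (u \in B) = (h u \in A)) ->
  represents (H := attach_leaves B) (leafy n es A)
    (fun x => match x with inl u => h u | inr u => n + h (val u) end).
Proof.
case=> h_inj hP hE /allP es_n /allP A_n BA.
have hn u : h u < n.
  by have /hP : exists x, h x = h u by [exists u]; rewrite mem_iota.
set g := fun x => _.
have g_inj : injective g.
  move=> [u|u] [v|v] /=.
  - by move/h_inj->.
  - by have := hn u; lia.
  - by have := hn v; lia.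
  - by move/addnI/h_inj/val_inj->.
split=> // [i|x y].
  rewrite mem_cat; split=> [/orP[/hP[x <-]|/mapP[u uA ->]]|[[u|u] <-]] /=.
  - by exists (inl x).
  - have /hP[v vu] : u \in iota 0 n by rewrite mem_iota; apply: A_n.
    have vB : v \in B by rewrite BA vu.
    by exists (inr (Sub v vB)); rewrite /= vu.
  - by rewrite mem_iota /= hn.
  - by rewrite map_f ?orbT // -BA; apply: valP.
have es_lt i j : (n <= i) || (n <= j) -> ((i, j) \in es) = false.
  by move=> nij; apply/negP=> /es_n /=; lia.
have leafE i j : ((i, j) \in [seq (u, n + u) | u <- A]) = (i \in A) && (j == n + i).
  apply/mapP/andP=> [[u uA [-> ->]]|[iA /eqP->]]; first by rewrite uA.
  by exists i.
have gap m u : (h u == n + m) = false.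
  by apply/negP=> /eqP hu; have := hn u; rewrite hu ltnNge leq_addr.
rewrite /= /sym_edge /= /adj !mem_cat !leafE -(inj_eq g_inj) /g.
case: x y => [u|u] [v|v] /=.
- rewrite !gap !andbF !orbF [edge v u]edge_sym orbb hE /adj /=.
  by case: (_ == _).
- rewrite !gap !es_lt ?leq_addr ?orbT // andbF !orbF eqn_add2l (inj_eq h_inj).
  rewrite [_ == u]eq_sym; case: eqP => [->|_] /=; last by rewrite andbF.
  by rewrite -BA (valP v).
- rewrite [_ == h v]eq_sym !gap !es_lt ?leq_addr ?orbT // andbF orbF eqn_add2l (inj_eq h_inj).
  rewrite [_ == v]eq_sym; case: eqP => [->|_] /=; last by rewrite andbF.
  by rewrite -BA (valP u).
by rewrite !es_lt ?leq_addr ?orbT // !eqn_add2l !gap !andbF.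
Qed.

(** [Q4], of index 5, is the default value of [nth]. *)
Definition pattern_graph (f : nat) : sgraph :=
  nth Q4 [:: path_graph 7; cycle_graph 7; Q1; Q2; Q3] f.

Lemma forbidden_pattern_graph H :
  forbidden H <-> exists2 f, f < size patterns & H = pattern_graph f.
Proof.
split; first by case; [exists 0 | exists 1 | exists 2 | exists 3 | exists 4 | exists 5].
by case=> -[|[|[|[|[|[|f]]]]]] // _ ->; constructor.
Qed.

Lemma pattern_graph_represents f : f < size patterns ->
  exists h, represents (H := pattern_graph f) (pattern f) h.
Proof.
have memT n (u : 'I_n) : (u \in setT) = (val u \in iota 0 n).
  by rewrite inE mem_iota ltn_ord.
have cycleP n := @represents_ord n [rel i j | i.+1 %% n == j] (cycle_edges n).
have edgesP es := @represents_ord 5 [rel i j | (i, j) \in es] es.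
case: f => [|[|[|[|[|[|f]]]]]] // _.
- by exists val; apply: (@represents_ord 7 [rel i j | i.+1 == j] (path_edges 7)).
- by exists val; apply: (cycleP 7).
- by eexists; apply: represents_leaves (cycleP 5 _) _ _ (memT 5).
- by eexists; apply: represents_leaves (cycleP 4 _) _ _ (memT 4).
- by eexists; apply: represents_leaves (edgesP H1_edges _) _ _ _ => // u; rewrite inE.
- by eexists; apply: represents_leaves (edgesP H2_edges _) _ _ _ => // u; rewrite inE.
Qed.

Lemma patterns_twin_free f : f < size patterns -> twin_free (pattern f).
Proof. by case: f => [|[|[|[|[|[|f]]]]]]. Qed.

(** * Enumeration of the connected dominating sets of a forbidden graph *)

Fixpoint all_sub (s : seq nat) (p : seq nat -> bool) : bool :=
  if s is i :: s' then all_sub s' p && all_sub s' (fun t => p (i :: t)) else p [::].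

Lemma all_subP s p (d : pred nat) : all_sub s p -> p (filter d s).
Proof.
elim: s p => //= i s IH p /andP[/IH p1 /IH p2].
by case: (d i).
Qed.

Section Undominated.
Variable r : rel nat.

(* Explores from [X] with fuel [m]; [Y] is what remains to be visited. *)
Fixpoint disconnected m (X Y : seq nat) : bool :=
  if m is m'.+1 then
    let far := [seq j <- Y | ~~ has (r j) X] in
    if size far == size Y then ~~ nilp Y else
      disconnected m' ([seq j <- Y | has (r j) X] ++ X) far
  else false.

(** When the exploration stalls before visiting everything, the visited vertices form [Z]. Exhausted
    fuel answers [false], so a positive answer is always justified. *)
Lemma disconnectedP m X Y :
  {in Y, forall j, j \notin X} -> disconnected m X Y ->
  exists Z : pred nat, [/\ {subset X <= Z}, exists2 y, y \in Y & ~~ Z y &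
    {in X ++ Y &, forall i j, Z i -> ~~ Z j -> ~~ r j i}].
Proof.
elim: m X Y => //= m IH X Y XY; case: eqP => [full|_].
  have far j : j \in Y -> ~~ has (r j) X.
    by move: full => /eqP; rewrite size_filter -all_count => /allP; apply.
  case: Y XY far {full} => //= y Y XY far _.
  exists (mem X); split=> //; first by exists y; rewrite ?mem_head ?XY ?mem_head.
  move=> i j _; rewrite mem_cat => /orP[jX|jY] /= iX jX'; first by rewrite jX in jX'.
  by have /hasPn := far j jY; apply.
case/IH=> [j|Z [XZ [y yY Zy] cut]].
  rewrite mem_filter mem_cat negb_or => /andP[nj jY].
  by rewrite mem_filter (negbTE nj) XY.
exists Z; split=> [j jX||i j iXY jXY].
- by apply: XZ; rewrite mem_cat jX orbT.
- by exists y => //; move: yY; rewrite mem_filter => /andP[].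
apply: cut; rewrite !mem_cat !mem_filter.
  by move: iXY; rewrite mem_cat; case: has; case: (i \in Y); rewrite ?orbT.
by move: jXY; rewrite mem_cat; case: has; case: (j \in Y); rewrite ?orbT.
Qed.

Definition dominates_in (s t : seq nat) :=
  all (fun i => (i \in t) || has (r i) t) s.

(* Conditionals, because boolean connectives are strict under [vm_compute]. *)
Fixpoint splittable (t S K : seq nat) : bool :=
  if t is i :: t' then
    if (if all (r i) K then splittable t' S (i :: K) else false) then true
    else if has (r i) S then false else splittable t' (i :: S) K
  else true.

(** Completeness of the search: a split partition, with [k] marking the clique, guides it to
    success. The contrapositive is what refutes splitness. *)
Lemma splittableP (k : pred nat) t S K :
  uniq (t ++ S ++ K) -> all k K -> all (predC k) S ->
  {in t ++ S ++ K &, forall i j, i != j ->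
     if r i j then k i || k j else ~~ (k i && k j)} ->
  splittable t S K.
Proof.
elim: t S K => //= i t IH S K /andP[iN uN] kK kS clS.
have iE : i \in i :: t ++ S ++ K by apply: mem_head.
have inE' j : j \in S ++ K -> (j \in i :: t ++ S ++ K) && (i != j).
  move=> jSK; rewrite inE mem_cat jSK !orbT /=.
  by apply: contraNneq iN => ->; rewrite mem_cat jSK orbT.
(* Moving [i] into [K] or into [S] only permutes the whole list. *)
have rec L : perm_eq L (i :: t ++ S ++ K) -> uniq L /\
    {in L &, forall i j, i != j -> if r i j then k i || k j else ~~ (k i && k j)}.
  move=> pL; rewrite (perm_uniq pL) /= iN uN; split=> // a b aL bL.
  by apply: clS; rewrite -(perm_mem pL).
have [|uK cK] := rec (t ++ S ++ i :: K).
  by rewrite catA -cat1s perm_catCA /= catA perm_refl.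
have [|uS cS] := rec (t ++ (i :: S) ++ K).
  by rewrite -(cat1s i S) -catA perm_catCA perm_refl.
case ki: (k i).
  have -> : all (r i) K.
    apply/allP=> j jK; have /andP[jin ij] : (j \in i :: t ++ S ++ K) && (i != j).
      by apply: inE'; rewrite mem_cat jK orbT.
    have := clS i j iE jin ij; rewrite ki (allP kK j jK).
    by case: r.
  by rewrite IH //= ki.
have -> : has (r i) S = false.
  apply/negbTE/hasPn=> j jS; have /andP[jin ij] : (j \in i :: t ++ S ++ K) && (i != j).
    by apply: inE'; rewrite mem_cat jS.
  have := clS i j iE jin ij; rewrite ki /= (negbTE (allP kS j jS)).
  by case: r.
have -> : splittable t (i :: S) K by apply: IH => //=; rewrite ki.
by case: ifP.
Qed.

Definition undominated (s : seq nat) :=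
  all_sub s (fun t =>
    if ~~ dominates_in s t then true
    else if disconnected (size t) (take 1 t) (behead t) then true
    else ~~ splittable t [::] [::]).

End Undominated.

(** Adjacencies are tabulated because the enumeration of all subsets queries them many times. *)
Definition table (es : seq (nat * nat)) n : rel nat :=
  let M := [seq [seq adj es i j | j <- iota 0 n] | i <- iota 0 n] in
  fun i j => nth false (nth [::] M i) j.

Lemma tableE es n i j : i < n -> j < n -> table es n i j = adj es i j.
Proof.
move=> i_n j_n; rewrite /table (nth_map 0) ?size_iota // (nth_map 0) ?size_iota //.
by rewrite !nth_iota.
Qed.

(** The bound 10 exceeds every vertex number; the largest is 5 + 4, for the leaf of the vertex 4. *)
Lemma patterns_undominated f : f < size patterns ->
  undominated (table (pattern f).2 10) (pattern f).1.
Proof. by case: f => [|[|[|[|[|[|f]]]]]] // _; vm_compute. Qed.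

Lemma patterns_buildable f : f < size patterns ->
  buildable (pattern f).2 (rev (pattern f).1).
Proof. by case: f => [|[|[|[|[|[|f]]]]]]. Qed.

(** [D] is encoded as the sublist [t] of [s]. The three outcomes of the test on [t] contradict
    domination, connectivity and splitness respectively. *)
Lemma undominatedP (G : sgraph) r s (e : nat -> G) (D : {set induced [set:: map e s]}) :
  uniq s -> {in s &, injective e} -> {in s &, forall i j, edge (e i) (e j) = r i j} ->
  undominated r s -> dominating D -> connected (induced D) -> ~ split_graph (induced D).
Proof.
move=> us e_inj re und domD /connected_induced[D0 /connP cD] [S [K [SK disSK stS clK]]].
pose A := [set:: map e s].
have eA i : i \in s -> e i \in A by move=> is_; rewrite inE map_f.
have Ae (z : induced A) : exists2 i, i \in s & val z = e i.
  by have := valP z; rewrite inE => /mapP.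
pose d i := [exists z in D, val z == e i].
pose t := filter d s.
have dP i (is_ : e i \in A) : d i = (Sub (e i) is_ \in D).
  apply/exists_inP/idP => [[z zD /eqP ze]|iD]; last by exists (Sub (e i) is_).
  by rewrite (_ : Sub _ _ = z) //; apply: val_inj.
have tP z : z \in D -> exists2 i, i \in t & val z = e i.
  move=> zD; have [i is_ zi] := Ae z; exists i => //.
  by rewrite mem_filter is_ andbT; apply/exists_inP; exists z; rewrite ?zi.
have ts i : i \in t -> i \in s by rewrite mem_filter => /andP[].
have [z0 z0D] := set0Pn _ D0.
have := all_subP d und; rewrite -/t; case: ifP => [/negP[]|_].
  apply/allP=> i is_; rewrite mem_filter is_ andbT (dP i (eA i is_)).
  case: (boolP (_ \in D)) => //= /domD[y yD iy].
  have [j jt yj] := tP y yD; have {iy} : edge (e i) (val y) by exact: iy.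
  by rewrite yj re ?(ts j) // => ij; apply/hasP; exists j.
case: ifP => [disc _|_ /negP]; last apply.
  have [t0 tE] : exists t0, t = t0 :: behead t.
    by have [i it _] := tP z0 z0D; case: (t) it => // t0 t' _; exists t0.
  have ut : uniq t by apply: filter_uniq.
  move: disc ut; rewrite {2 3 4}tE /= take0 => disc /andP[t0n _].
  have [|Z [t0Z [y yt Zy] cut]] := disconnectedP _ disc.
    by move=> j jt; rewrite inE; apply: contraNneq t0n => <-.
  have lift i : i \in t -> exists2 z, z \in D & val z = e i.
    by rewrite mem_filter => /andP[/exists_inP[z zD /eqP zi] _]; exists z.
  have yt' : y \in t by rewrite tE inE yt orbT.
  have t0t : t0 \in t by rewrite tE mem_head.
  have [a aD ae] := lift t0 t0t.
  have [b bD be] := lift y yt'.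
  pose X := [set z : induced A | has (fun i => Z i && (val z == e i)) t].
  have XE z i : i \in t -> val z = e i -> (z \in X) = Z i.
    move=> it zi; rewrite inE; apply/hasP/idP => [[j jt /andP[Zj]]|Zi]; last first.
      by exists i; rewrite // Zi zi eqxx.
    by rewrite zi => /eqP/e_inj ->; rewrite ?ts.
  have aX : a \in X by rewrite (XE a t0) //; apply: t0Z; apply: mem_head.
  have bX : b \notin X by rewrite (XE b y).
  have [u [v [uD uX vD vX uv]]] := cD X a b aD aX bD bX.
  have [i it ui] := tP u uD; have [j jt vj] := tP v vD.
  have : edge (val u) (val v) by exact: uv.
  rewrite (XE u i) // in uX; rewrite (XE v j) // in vX.
  rewrite edge_sym ui vj re ?ts //; apply/negP; apply: cut => //.
    by rewrite /= -tE.
  by rewrite /= -tE.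
pose k i := [exists z in K, val (val z) == e i].
apply: (splittableP (k := k)); rewrite ?cats0 ?filter_uniq //.
have zP l : l \in t -> exists2 z : induced D, val (val z) = e l & (z \in K) = k l.
  rewrite mem_filter => /andP[/exists_inP[y yD /eqP yl] _].
  exists (Sub y yD) => //; apply/idP/exists_inP=> [yK|[z zK /eqP zl]].
    by exists (Sub y yD) => //=; rewrite yl.
  by rewrite (_ : Sub y yD = z) //; do 2!apply: val_inj; rewrite zl.
move=> i j it jt ij; have [zi zie <-] := zP i it; have [zj zje <-] := zP j jt.
have zE : edge zi zj = r i j by rewrite -re ?ts // -zie -zje.
have SK' z : (z \in S) || (z \in K) by have := in_setT z; rewrite -SK inE.
case: ifP => aij.
  case: (boolP (zi \in K)) => //= ziK; have := SK' zi; rewrite (negbTE ziK) orbF => ziS.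
  case: (boolP (zj \in K)) => //= zjK; have := SK' zj; rewrite (negbTE zjK) orbF => zjS.
  by have := stS _ _ ziS zjS; rewrite zE aij.
apply/andP=> -[ziK zjK].
have : zi != zj.
  by apply: contraNneq ij => zz; apply/eqP/e_inj; rewrite ?ts // -zie -zje zz.
by move/(clK _ _ ziK zjK); rewrite zE aij.
Qed.

(** * The equivalence, from the certificates and the enumeration *)

Lemma cores_refuted p : p \in cores ->
  exists ends c, all (end_ok p.1 p.2) ends && check p.1 p.2 ends c [::] [::] [::].
Proof.
rewrite !inE => /or4P[|||/orP[]] /eqP-> /=.
- by exists P5_ends, P5_cert.
- by exists (cycle_ends 5), C5_cert.
- by exists (cycle_ends 4), C4_cert; vm_compute.
- by exists H1_ends, H1_cert.
- by exists H2_ends, H2_cert.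
Qed.

Lemma split_dominating (H : sgraph) : connected H ->
  (forall f (e : nat -> H), f < size patterns -> ~ realizes (pattern f) e) ->
  exists D : {set H}, [/\ dominating D, connected (induced D) & split_graph (induced D)].
Proof.
move=> cH nopat; have [D D0 optD] := optimal_exists cH.
have [cD domD _] := optD.
have cID : connected (induced D) by apply/connected_induced.
exists D; split=> //; first by move=> x; apply: dominatesP.
apply: split_of_no_core => // p pcore [x [x_inj x_adj]].
have [ends [c /andP[endsP ok]]] := cores_refuted pcore.
apply: (@no_core p.1 p.2 ends H D (fun i => val (x i)) nopat optD _ _ _ endsP c ok).
- by move=> i _; apply: valP.
- by move=> i j ik jk /val_inj; apply: x_inj.
- exact: x_adj.
Qed.

Theorem theorem3p1 (G : sgraph) :
  (forall F : {set G}, connected (induced F) ->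
     exists D : {set induced F},
       [/\ dominating D, connected (induced D) & split_graph (induced D)])
  <-> free forbidden G.
Proof.
split=> [dom H /forbidden_pattern_graph[f fP ->]|freeG F cF].
  have [h rep] := pattern_graph_represents fP; have tf := patterns_twin_free fP.
  have P0 : 0 \in (pattern f).1 by case: f fP {h rep tf} => [|[|[|[|[|[|f]]]]]].
  move=> /(contains_realizes rep P0)[e re].
  set s := (pattern f).1 in P0 *.
  (* The copy of the forbidden graph is connected, so the hypothesis applies to it. *)
  have cA : connected (induced [set:: map e s]).
    apply/connected_induced; split; first by apply/set0Pn; exists (e 0); rewrite inE map_f.
    have -> : [set:: map e s] = [set:: map e (rev s)].
      by apply/setP=> z; rewrite !inE map_rev mem_rev.
    apply: conn_buildable (patterns_buildable fP) => i j.
    by rewrite !mem_rev; apply: re.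
  have [D [domD cD]] := dom _ cA.
  have [us s10] : uniq s /\ all (ltn^~ 10) s.
    by rewrite /s; case: f fP {h rep tf P0 re cA s D domD cD} => [|[|[|[|[|[|f]]]]]].
  apply: undominatedP (patterns_undominated fP) domD cD => //.
    exact: realizes_inj tf re.
  by move=> i j is_ js; rewrite tableE ?re //; apply: (allP s10).
apply: split_dominating => // f e fP re.
have [h rep] := pattern_graph_represents fP.
apply: (freeG (pattern_graph f)); first by apply/forbidden_pattern_graph; exists f.
(* A pattern found in [induced F] is carried into [G] by [val]. *)
exact: (@realizes_contains _ _ _ h (val \o e)) rep (patterns_twin_free fP) _.
Qed.
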